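(* Let $0<\theta<1$ and $B\ge 1$ be fixed. There exist a constant $C_{\theta,B}>0$ and a threshold $T_0$, each depending only on $\theta$ and $B$, such that for all $T\ge T_0$ and all real $N$ with $$2\le N\le (\log T\,\log_2 T)^B,$$ one has $$\max_{T^\theta\le t\le T}|\zeta_N(1+\mathrm{i}t)|\ \ge\ (\log_2 T+\log_3 T)\int_0^{\frac{\log N}{\log_2 T+\log_3 T}}\rho(u)\,\mathrm{d}u\;-\;C_{\theta,B}.$$
   Context: For $N\ge 2$ and $s\in\mathbb{C}$, $\zeta_N(s)=\sum_{n\le N} n^{-s}$ denotes the partial sum of the Riemann zeta function, where the sum is over positive integers $n\le N$. The symbol $\log_j$ denotes the $j$-th iterated natural logarithm, so $\log_2 T=\log\log T$ and $\log_3 T=\log\log\log T$. The function $\rho:[0,\infty)\to\mathbb{R}$ is the Dickman function: the unique continuous function with $\rho(u)=1$ for $0\le u\le 1$ and $u\rho'(u)=-\rho(u-1)$ for $u>1$. *)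

(* Defs.v *)
From Stdlib Require Import Reals.
From Coquelicot Require Import Coquelicot.
Open Scope R_scope.

Definition Cexp (z : C) : C :=
  (exp (Re z) * cos (Im z), exp (Re z) * sin (Im z)).

(* n^(-s) = exp(-s log n); only meaningful for n >= 1. *)
Definition npow_opp (n : nat) (s : C) : C :=
  Cexp (Copp s * RtoC (ln (INR n)))%C.

Definition zeta_partial (N : R) (s : C) : C :=
  sum_n_m (fun n : nat => npow_opp n s) 1 (Z.to_nat (Zfloor N)).

Definition iter_log (j : nat) (x : R) : R := Nat.iter j ln x.

(* The Dickman function lives on [0, +oo), and these conditions determine it
   there; the values at negative arguments are irrelevant. *)
Definition is_dickman (rho : R -> R) : Prop :=
  continuous_on (fun u => 0 <= u) rho /\
  (forall u, 0 <= u <= 1 -> rho u = 1) /\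
  (forall u, 1 < u -> ex_derive rho u /\ u * Derive rho u = - rho (u - 1)).

Definition is_max_on (f : R -> R) (a b M : R) : Prop :=
  (exists t, a <= t <= b /\ f t = M) /\
  (forall t, a <= t <= b -> f t <= M).

(* Main.v *)
Require Import Defs.
From Stdlib Require Import Reals Lra Psatz.
From Coquelicot Require Import Coquelicot.
From HB Require Import structures.
From mathcomp Require Import all_boot zify.
Open Scope R_scope.

(** The proof is the resonance method. Put [X = c ln T ln ln T] with a small
   constant [c], and let [R(t)] be the product over primes [p <= X] of
   [1 / (1 - q_p p^(i t))] with [q_p = 1 - p / X]. Average [zeta_N(1 + i t)]
   against [|R(t)|^2], where [t] runs over the differences [j - l] of integers
   [0 <= j, l < K], with [K] the integer part of [T]. An exponential [e^(i v t)]
   has average [|\sum_(j < K) e^(i v j)|^2 >= 0], so any product of series of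
   exponentials with nonnegative coefficients has a nonnegative average. For
   an [X]-smooth [n] the function [(n^(i t) - q_n) |R(t)|^2], with [q] extended
   completely multiplicatively, is a sum of such products; hence the weighted mean of
   [zeta_N(1 + i t)] is at least the sum of [q_n / n] over [X]-smooth [n <= N].
   With [sopfr(n)] the sum of the prime factors of [n], the simpler
   [1 - sopfr(n) / X <= q_n] serves in place of [q_n] throughout
   ([preserving_shift], [pair_sum_cos_ge]).

   Two facts about primes make this choice of [q_p] work, and both follow from
   Chebyshev's bound. First, [\sum_n sopfr(n) / n] over smooth [n <= N] is
   [O(pi(X) ln N) = O(X)], so replacing [1 - sopfr(n) / X] by [1] costs only
   [O(1)] ([resonated_sum_ge]). Second,
   [|R(0)|^2 = \prod_p (X/p)^2 = exp (O(X / ln X))] is a small power of [T]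
   when [c] is small ([sum_ln_ratio_primes]); since [|R|^2] is largest at [0]
   and never below [4^(- pi(X))], the range [|t| < T^theta], of density
   [O(T^(theta - 1))], contributes [o(1)] to the mean ([resonance]). So the
   maximum over [[T^theta, T]] is at least the sum of [1/n] over [X]-smooth
   [n <= N], up to [O(1)].

   It remains to bound that sum below by [ln X \int_0^u rho - O(1)], where
   [u = ln N / ln X] is bounded ([smooth_sum_lower]). The function
   [F(u) = \int_0^u rho] satisfies [u F(u) = \int_0^u F + \int_(u-1)^u F]
   for [u >= 1] ([dickman_int_eq]). Splitting one prime off each smooth number
   and using Mertens' lower bound for [\sum ln p / p], the normalised smooth sum
   satisfies the corresponding inequality with an error [O(1 / ln X)]
   ([profile_recurrence]). On [[0, 1]] it is at least [u = F(u)], and a Gronwall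
   argument carries the comparison to larger [u]. Finally, passing from the
   scale [ln X] to [ln ln T + ln ln ln T = ln X + O(1)] changes the bound by
   [O(1)] ([dickman_rescale]). *)

(** * Finite sums of real numbers *)

HB.instance Definition _ := Monoid.isComLaw.Build R 0 Rplus
  (fun x y z => esym (Rplus_assoc x y z)) Rplus_comm Rplus_0_l.
HB.instance Definition _ := Monoid.isComLaw.Build R 1 Rmult
  (fun x y z => esym (Rmult_assoc x y z)) Rmult_comm Rmult_1_l.
HB.instance Definition _ := Monoid.isMulLaw.Build R 0 Rmult Rmult_0_l Rmult_0_r.
HB.instance Definition _ := Monoid.isAddLaw.Build R Rmult Rplus
  Rmult_plus_distr_r Rmult_plus_distr_l.

Notation "\rsum_ ( m <= i < n | P ) F" :=
  (\big[Rplus/0]_(m <= i < n | P%B) F)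
  (at level 34, F at level 41, i, m, n at level 50).
Notation "\rsum_ ( m <= i < n ) F" :=
  (\big[Rplus/0]_(m <= i < n) F)
  (at level 34, F at level 41, i, m, n at level 50).

Arguments INR : simpl never.

Lemma INR0 : INR 0 = 0. Proof. by []. Qed.
Lemma INR1 : INR 1 = 1. Proof. by []. Qed.

Lemma INRD (m n : nat) : INR (m + n)%N = INR m + INR n.
Proof. by rewrite -plus_INR. Qed.

Lemma INRM (m n : nat) : INR (m * n)%N = INR m * INR n.
Proof. by rewrite -mult_INR. Qed.

Section Sums.
Implicit Types (I : Type) (T : eqType).

Lemma rsum_ge0 I (s : seq I) (P : pred I) F :
  (forall i, P i -> 0 <= F i) -> 0 <= \big[Rplus/0]_(i <- s | P i) F i.
Proof.
move=> h; apply: (big_ind (fun x => 0 <= x)); [lra| |exact: h].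
by move=> x y hx hy; lra.
Qed.

Lemma rsum_le T (s : seq T) (P : pred T) F G :
  (forall i, i \in s -> P i -> F i <= G i) ->
  \big[Rplus/0]_(i <- s | P i) F i <= \big[Rplus/0]_(i <- s | P i) G i.
Proof.
move=> h; rewrite big_seq_cond [X in _ <= X]big_seq_cond.
apply: (big_ind2 Rle); [lra| |].
- by move=> x1 x2 y1 y2 hx hy; exact: Rplus_le_compat.
- by move=> i /andP[hi hP]; exact: h.
Qed.

Lemma rsum_sub I (s : seq I) (P Q : pred I) F :
  (forall i, P i -> Q i) -> (forall i, Q i -> 0 <= F i) ->
  \big[Rplus/0]_(i <- s | P i) F i <= \big[Rplus/0]_(i <- s | Q i) F i.
Proof.
move=> hPQ hF; rewrite big_mkcond [X in _ <= X]big_mkcond.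
apply: (big_ind2 Rle); [lra| |].
- by move=> x1 x2 y1 y2 hx hy; exact: Rplus_le_compat.
- move=> i _; case: ifP => hP; first by rewrite hPQ //; lra.
  by case: ifP => hQ; [exact: hF|lra].
Qed.

Lemma rsum_const I (s : seq I) (P : pred I) a :
  \big[Rplus/0]_(i <- s | P i) a = INR (count P s) * a.
Proof.
elim: s => [|x s IH]; first by rewrite big_nil /= INR0; lra.
rewrite big_cons IH /= INRD; case: (P x) => /=; rewrite ?INR0 ?INR1; lra.
Qed.

Lemma rsum_opp I (s : seq I) (P : pred I) F :
  \big[Rplus/0]_(i <- s | P i) - F i = - \big[Rplus/0]_(i <- s | P i) F i.
Proof.
elim: s => [|x s IH]; first by rewrite !big_nil; lra.
by rewrite !big_cons IH; case: (P x) => /=; lra.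
Qed.

Lemma rsum_minus I (s : seq I) (P : pred I) F G :
  \big[Rplus/0]_(i <- s | P i) (F i - G i) =
  \big[Rplus/0]_(i <- s | P i) F i - \big[Rplus/0]_(i <- s | P i) G i.
Proof. by rewrite big_split rsum_opp. Qed.

Lemma rsum_widen (m n n' : nat) (P : pred nat) F :
  (n <= n')%N -> (forall i, (m <= i)%N -> P i -> 0 <= F i) ->
  \rsum_(m <= i < n | P i) F i <= \rsum_(m <= i < n' | P i) F i.
Proof.
move=> hn hF; rewrite (big_nat_widen _ _ _ _ _ hn) big_nat_cond [X in _ <= X]big_nat_cond.
apply: rsum_sub.
- by move=> i /andP[/andP[h1 h2] /andP[h3 h4]]; rewrite h1 h2 h3.
- by move=> i /andP[/andP[h1 h2] h3]; apply: hF.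
Qed.

Lemma rsum_multiples (p x : nat) F : (0 < p)%N ->
  \rsum_(1 <= n < x.+1 | p %| n) F n =
  \rsum_(1 <= m < (x %/ p).+1) F (p * m)%N.
Proof.
move=> p0; rewrite -big_filter -(big_map (fun m => (p * m)%N) predT F).
apply: perm_big; apply: uniq_perm.
- by rewrite filter_uniq // iota_uniq.
- rewrite map_inj_uniq ?iota_uniq // => a b /eqP.
  by rewrite eqn_pmul2l // => /eqP.
move=> n; rewrite mem_filter mem_index_iota; apply/idP/mapP.
- move=> /andP[hd /andP[h1 h2]]; exists (n %/ p)%N; last by rewrite mulnC divnK.
  by rewrite mem_index_iota divn_gt0 // dvdn_leq // ltnS leq_div2r.
- move=> [m]; rewrite mem_index_iota => /andP[h1 h2] ->.
  rewrite dvdn_mulr // muln_gt0 p0 h1 /= ltnS mulnC -leq_divRL //.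
Qed.

End Sums.

Lemma INR_leq (m n : nat) : (m <= n)%N -> INR m <= INR n.
Proof. by move=> h; apply: le_INR; apply/leP. Qed.

Lemma INR_gt0 n : (0 < n)%N -> 0 < INR n.
Proof. by move=> h; apply: lt_0_INR; apply/ltP. Qed.

Lemma INR_ge1 n : (0 < n)%N -> 1 <= INR n.
Proof. by move=> /INR_leq. Qed.

Lemma ln_INR_ge0 n : 0 <= ln (INR n).
Proof.
case: n => [|n]; first by rewrite /ln INR0; case: Rlt_dec => [h|_]; [case: (Rlt_irrefl _ h)|exact: Rle_refl].
by rewrite -ln_1; apply: ln_le; [lra|apply: INR_ge1].
Qed.

Lemma exp_le x y : x <= y -> exp x <= exp y.
Proof. by case=> [/exp_increasing|->]; [exact: Rlt_le|exact: Rle_refl]. Qed.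

Lemma ln_le_sub1 x : 0 < x -> ln x <= x - 1.
Proof.
move=> hx; have := exp_ineq1_le (ln x); rewrite exp_ln //; lra.
Qed.

Lemma inv_INR_ge0 n : 0 <= / INR n.
Proof.
case: n => [|n]; first by rewrite Rinv_0; lra.
by apply: Rlt_le; apply: Rinv_0_lt_compat; apply: INR_gt0.
Qed.

(** * Smooth numbers *)

Definition smooth (X n : nat) : bool := all (fun p => (p <= X)%N) (primes n).

Lemma smoothM X m n : (0 < m)%N -> (0 < n)%N ->
  smooth X (m * n) = smooth X m && smooth X n.
Proof.
move=> hm hn; apply/allP/andP => [h|[/allP h1 /allP h2] p].
- by split; apply/allP => p hp; apply: h; rewrite primesM // hp ?orbT.
- by rewrite primesM // => /orP[/h1|/h2].
Qed.

Lemma smooth_prime X p : prime p -> smooth X p = (p <= X)%N.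
Proof. by move=> hp; rewrite /smooth primes_prime //= andbT. Qed.

Lemma smooth_le X n : (0 < n)%N -> (n <= X)%N -> smooth X n.
Proof.
move=> n0 hn; apply/allP => p; rewrite mem_primes => /and3P[_ _ hd].
by apply: leq_trans hn; apply: dvdn_leq.
Qed.

(** Multiplicative induction, one prime factor at a time; it replaces unique
   factorisation both for [ln n] and for the resonator coefficients. *)
Lemma smooth_ind X (P : nat -> Prop) : P 1%N ->
  (forall p n, prime p -> (p <= X)%N -> (0 < n)%N -> smooth X n -> P n -> P (p * n)%N) ->
  forall n, (0 < n)%N -> smooth X n -> P n.
Proof.
move=> h1 hS; elim/ltn_ind => n IH n0 hs.
case: (ltnP 1 n) => [n1|]; last by case: n n0 {IH hs} => [|[|]].
have [p hp /dvdnP[q e]] : exists2 p, prime p & (p %| n)%N.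
  by exists (pdiv n); [exact: pdiv_prime|exact: pdiv_dvd].
rewrite mulnC in e; subst n; move: n0; rewrite muln_gt0 => /andP[p0 q0].
move: hs; rewrite smoothM // smooth_prime // => /andP[hpX hs].
apply: hS => //; apply: IH => //.
by rewrite ltn_Pmull ?prime_gt1.
Qed.

(** Stated for an arbitrary weight [F] because two weights occur: [ln p], which
   recovers [ln n], and [p], which gives the sum of prime factors that
   measures the loss in the resonator. *)
Lemma rsum_lognM X p n (F : nat -> R) : prime p -> (p <= X)%N -> (0 < n)%N ->
  \rsum_(1 <= q < X.+1 | prime q) INR (logn q (p * n)) * F q =
  F p + \rsum_(1 <= q < X.+1 | prime q) INR (logn q n) * F q.
Proof.
move=> hp hpX n0.
rewrite (eq_bigr (fun q => INR (logn q p) * F q + INR (logn q n) * F q)); last first.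
  by move=> q hq; rewrite lognM ?(prime_gt0 hp) // INRD; lra.
rewrite big_split /=; congr (_ + _).
rewrite big_mkcond (bigD1_seq p) /= ?iota_uniq ?mem_index_iota ?prime_gt0 //.
rewrite hp logn_prime // eqxx big1 /= ?INR1; first by lra.
move=> q hqp; case: ifP => // hq; rewrite logn_prime //.
by rewrite (negbTE hqp) /= INR0; lra.
Qed.

Lemma ln_smooth X n : (0 < n)%N -> smooth X n ->
  ln (INR n) = \rsum_(1 <= p < X.+1 | prime p) INR (logn p n) * ln (INR p).
Proof.
move: n; apply: smooth_ind.
  rewrite INR1 ln_1 big1 // => p _; rewrite logn1 INR0; lra.
move=> p n hp hpX n0 hs IH.
rewrite INRM ln_mult; try by apply: INR_gt0; rewrite // prime_gt0.
by rewrite IH (rsum_lognM X p n (fun q => ln (INR q))).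
Qed.

Definition smooth_sum (X x : nat) : R :=
  \rsum_(1 <= n < x.+1 | smooth X n) / INR n.

Lemma smooth_sum_ge0 X x : 0 <= smooth_sum X x.
Proof. by apply: rsum_ge0 => i _; exact: inv_INR_ge0. Qed.

Definition harmonic (x : nat) := \rsum_(1 <= n < x.+1) / INR n.

Lemma harmonic_ge x : ln (INR x.+1) <= harmonic x.
Proof.
elim: x => [|x IH]; first by rewrite /harmonic big_geq // INR1 ln_1; lra.
rewrite /harmonic big_nat_recr //= -/(harmonic x).
have h1 := INR_gt0 x.+1 (ltn0Sn x).
have h2 := INR_gt0 x.+2 (ltn0Sn _).
have -> : INR x.+2 = INR x.+1 * (INR x.+2 / INR x.+1) by field; lra.
rewrite ln_mult //; last by apply: Rdiv_lt_0_compat.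
have := ln_le_sub1 (INR x.+2 / INR x.+1) (Rdiv_lt_0_compat _ _ h2 h1).
have -> : INR x.+2 / INR x.+1 - 1 = / INR x.+1.
  by rewrite (S_INR x.+1); field; lra.
lra.
Qed.

Lemma harmonic_le x : (0 < x)%N -> harmonic x <= 1 + ln (INR x).
Proof.
case: x => // x _; elim: x => [|x IH].
  by rewrite /harmonic big_nat1 /= INR1 ln_1 Rinv_1; lra.
rewrite /harmonic big_nat_recr //= -/(harmonic x.+1).
have h1 := INR_gt0 x.+1 (ltn0Sn x).
have h2 := INR_gt0 x.+2 (ltn0Sn _).
have h3 : 0 < INR x.+1 / INR x.+2 by apply: Rdiv_lt_0_compat.
have := ln_le_sub1 _ h3.
rewrite ln_div //.
have -> : INR x.+1 / INR x.+2 - 1 = - / INR x.+2.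
  by rewrite (S_INR x.+1); field; rewrite -S_INR; lra.
lra.
Qed.

Lemma smooth_sum_le X x : smooth_sum X x <= harmonic x.
Proof. by apply: rsum_sub => // i _; exact: inv_INR_ge0. Qed.

Lemma smooth_sum_small X x : (x <= X)%N -> smooth_sum X x = harmonic x.
Proof.
move=> h; rewrite /smooth_sum /harmonic big_nat_cond [RHS]big_nat_cond.
apply: eq_bigl => n; rewrite andbT andb_idr // => /andP[h1 h2].
by apply: smooth_le => //; rewrite -ltnS; apply: leq_trans h2 _; rewrite ltnS.
Qed.

(** The elementary half of Stirling's formula, [n! >= (n/e)^n]. *)
Lemma sum_ln_ge n : INR n * ln (INR n) - INR n <= \rsum_(1 <= k < n.+1) ln (INR k).
Proof.
elim: n => [|n IH]; first by rewrite big_geq //= INR0; lra.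
rewrite big_nat_recr //=.
case: n IH => [|n] IH; first by rewrite big_geq //= INR1 ln_1; lra.
have h1 := INR_gt0 n.+1 (ltn0Sn n).
have h2 := INR_gt0 n.+2 (ltn0Sn _).
have h3 : 0 < INR n.+2 / INR n.+1 by apply: Rdiv_lt_0_compat.
have := ln_le_sub1 _ h3; rewrite ln_div // => h.
have : INR n.+1 * (ln (INR n.+2) - ln (INR n.+1)) <= 1.
  apply: Rle_trans (_ : INR n.+1 * (INR n.+2 / INR n.+1 - 1) <= _).
    by apply: Rmult_le_compat_l => //; lra.
  by rewrite (S_INR n.+1); right; field; lra.
have := S_INR n.+1. nra.
Qed.

(** * Elementary bounds of Mertens and Chebyshev *)



Lemma INR_prime_ge2 p : prime p -> 2 <= INR p.
Proof. by move=> /prime_gt1 /INR_leq; rewrite S_INR INR1; lra. Qed.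

(** Only multiples [n = p m] contribute, and [v_p(p m) = 1 + v_p(m)]. Applying
   this identity to a sum and comparing the result with the same sum bounds
   all prime powers at once, without summing over exponents. *)
Lemma rsum_logn p x (F : nat -> R) : prime p ->
  \rsum_(1 <= n < x.+1) (INR (logn p n) * F n) =
  \rsum_(1 <= m < (x %/ p).+1) ((1 + INR (logn p m)) * F (p * m)%N).
Proof.
move=> hp; rewrite (bigID (fun n => p %| n)) /= [X in _ + X]big1 ?Rplus_0_r; last first.
  by move=> n hn; rewrite lognE (negbTE hn) !andbF INR0; lra.
rewrite rsum_multiples ?prime_gt0 //.
rewrite big_nat_cond [RHS]big_nat_cond; apply: eq_bigr => m /andP[/andP[m0 _] _].
by rewrite lognM ?(prime_gt0 hp) // logn_prime // eqxx INRD INR1.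
Qed.

(** Legendre's bound [v_p(n!) <= n / (p - 1)]. *)
Lemma sum_logn_le p x : prime p ->
  (INR p - 1) * \rsum_(1 <= k < x.+1) INR (logn p k) <= INR x.
Proof.
move=> hp; have p2 := INR_prime_ge2 _ hp; elim/ltn_ind: x => x IH.
case: (posnP x) => [->|x0]; first by rewrite big_geq // INR0; lra.
rewrite (eq_bigr (fun k => INR (logn p k) * 1)); last by move=> i _; lra.
rewrite rsum_logn // (eq_bigr (fun k => 1 + INR (logn p k))); last by move=> i _; lra.
rewrite big_split /= rsum_const count_predT size_iota subn1 /=.
have h1 := IH (x %/ p)%N (ltn_Pdiv (prime_gt1 hp) x0).
have : INR (x %/ p * p)%N <= INR x by apply: INR_leq; exact: leq_divM.
rewrite INRM; nra.
Qed.

(** The terms telescope against [(ln m + 2) / m]. *)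
Lemma sum_ln_ratio_le n : (0 < n)%N ->
  \rsum_(2 <= m < n.+1) (ln (INR m) / (INR m * (INR m - 1))) <=
  2 - (ln (INR n) + 2) / INR n.
Proof.
case: n => // n _; elim: n => [|n IH].
  by rewrite big_geq // INR1 ln_1; lra.
rewrite big_nat_recr //=.
apply: Rle_trans (Rplus_le_compat_r _ _ _ IH) _.
have h1 := INR_gt0 n.+1 (ltn0Sn n).
have h2 := INR_gt0 n.+2 (ltn0Sn _).
have e := S_INR n.+1.
have h3 : 0 < INR n.+2 / INR n.+1 by apply: Rdiv_lt_0_compat.
have := ln_le_sub1 _ h3; rewrite ln_div // => h.
set a := INR n.+1 in h1 e h h3 *; set b := INR n.+2 in h2 e h h3 *.
set la := ln a in h *; set lb := ln b in h *.
have hb : b * (lb - la) <= 2.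
  apply: Rle_trans (_ : b * (b / a - 1) <= _).
    by apply: Rmult_le_compat_l => //; lra.
  rewrite e; apply: (Rmult_le_reg_r a) => //; field_simplify; try lra.
  have : 1 <= a by apply: INR_ge1.
  by nra.
have -> : b - 1 = a by lra.
apply/Rminus_le_0.
have -> : 2 - (lb + 2) / b - (2 - (la + 2) / a + lb / (b * a)) =
          ((la + 2) * b - lb - (lb + 2) * a) / (a * b) by field; lra.
apply: Rdiv_le_0_compat; last by apply: Rmult_lt_0_compat.
by rewrite e in hb *; lra.
Qed.

(** One half of Mertens' first theorem. Factoring [n!] gives
   [n ln n - n <= ln n! <= n \sum_(p <= n) ln p / (p - 1)], and replacing
   [p - 1] by [p] costs a convergent series. *)
Lemma mertens_lower n : (0 < n)%N ->
  ln (INR n) - 3 <= \rsum_(1 <= p < n.+1 | prime p) (ln (INR p) / INR p).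
Proof.
move=> n0; have hn := INR_gt0 n n0.
have h1 : INR n * ln (INR n) - INR n <=
   INR n * \rsum_(1 <= p < n.+1 | prime p) (ln (INR p) / (INR p - 1)).
  apply: Rle_trans (sum_ln_ge n) _.
  rewrite big_nat_cond (eq_bigr (fun k => \rsum_(1 <= p < n.+1 | prime p) (INR (logn p k) * ln (INR p)))); last first.
    move=> k /andP[/andP[k0 kn] _]; apply: ln_smooth => //.
    by apply: smooth_le.
  rewrite -big_nat_cond exchange_big /= big_distrr /=; apply: rsum_le => p _ hp.
  have p2 := INR_prime_ge2 _ hp.
  rewrite -big_distrl /=.
  have := sum_logn_le p n hp; set v := \big[_/_]_(_ <= _ < _) _ => hv.
  have -> : INR n * (ln (INR p) / (INR p - 1)) = (INR n / (INR p - 1)) * ln (INR p).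
    by field; lra.
  apply: Rmult_le_compat_r; first exact: ln_INR_ge0.
  by apply: (Rmult_le_reg_l (INR p - 1)); [lra|field_simplify; lra].
have h2 : \rsum_(1 <= p < n.+1 | prime p) (ln (INR p) / (INR p - 1)) <=
   \rsum_(1 <= p < n.+1 | prime p) (ln (INR p) / INR p) + 2.
  rewrite (eq_bigr (fun p => ln (INR p) / INR p + ln (INR p) / (INR p * (INR p - 1)))); last first.
    by move=> p hp; have := INR_prime_ge2 _ hp => ?; field; lra.
  rewrite big_split /=; apply: Rplus_le_compat_l.
  have h := sum_ln_ratio_le n n0.
  have h0 : 0 <= (ln (INR n) + 2) / INR n.
    by have := ln_INR_ge0 n => ?; apply: Rdiv_le_0_compat; lra.
  apply: Rle_trans (_ : 2 - (ln (INR n) + 2) / INR n <= _); last lra.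
  apply: Rle_trans h.
  rewrite big_ltn_cond //=.
  rewrite big_nat_cond [X in _ <= X]big_nat_cond.
  apply: rsum_sub => m; first by case/andP => ->.
  case/andP => /andP[m2 _] _; have := INR_leq _ _ m2; rewrite S_INR INR1 => hm.
  by apply: Rdiv_le_0_compat; [exact: ln_INR_ge0|nra].
have : ln (INR n) - 1 <= \rsum_(1 <= p < n.+1 | prime p) (ln (INR p) / (INR p - 1)).
  by apply: (Rmult_le_reg_l (INR n)) => //; lra.
lra.
Qed.

Definition chebyshev_theta (n : nat) := \rsum_(1 <= p < n.+1 | prime p) ln (INR p).

Lemma prime_dvd_fact p n : prime p -> (n < p)%N -> (p %| n`!)%N = false.
Proof.
move=> hp; elim: n => [|n IH] h; first by rewrite fact0 dvdn1; apply/eqP => e; rewrite e in hp.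
rewrite factS Euclid_dvdM // IH 1?ltnW // orbF.
by apply: gtnNdvd.
Qed.

Lemma bin_central_le n : ('C(n.*2, n) <= 4 ^ n)%N.
Proof.
have -> : (4 ^ n = 2 ^ n.*2)%N by rewrite -muln2 mulnC expnM.
have -> : (2 ^ n.*2 = \sum_(i < (n.*2).+1) 'C(n.*2, i))%N.
  rewrite -[2%N]/(1 + 1)%N expnDn; apply: eq_bigr => i _.
  by rewrite !exp1n !muln1.
have h : (n < (n.*2).+1)%N by rewrite ltnS -addnn leq_addr.
by rewrite (bigD1 (Ordinal h)) //= leq_addr.
Qed.

(** Every prime in [(n, 2n]] divides the central binomial coefficient, which is
   at most [4^n]. *)
Lemma theta_double n : chebyshev_theta n.*2 <= chebyshev_theta n + 2 * INR n.
Proof.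
pose c := 'C(n.*2, n); pose X := maxn c n.*2.
have hn2 : (n <= n.*2)%N by rewrite -addnn leq_addr.
have c0 : (0 < c)%N by rewrite bin_gt0.
have h1 : ln (INR c) <= 2 * INR n.
  apply: Rle_trans (_ : ln (INR (4 ^ n)) <= _).
    by apply: ln_le; [exact: INR_gt0|apply/INR_leq/bin_central_le].
  have -> : INR (4 ^ n)%N = (INR 4) ^ n.
    by elim: n {c X hn2 c0} => [|n IH] //=; rewrite expnS INRM IH.
  rewrite ln_pow; last by apply: INR_gt0.
  rewrite Rmult_comm; apply: Rmult_le_compat_r; first exact: pos_INR.
  have -> : INR 4 = 2 * 2 by rewrite /INR; ring.
  have := ln_le_sub1 2; rewrite ln_mult; lra.
have e := ln_smooth X c c0 (smooth_le _ _ c0 (leq_maxl _ _)).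
have h2 : chebyshev_theta n.*2 <= chebyshev_theta n + \rsum_(1 <= p < n.*2.+1 | prime p && (n < p)%N) ln (INR p).
  rewrite /chebyshev_theta (bigID (fun p => (p <= n)%N)) /=.
  rewrite (big_nat_widen 1 n.+1 n.*2.+1) //.
  apply: Rplus_le_compat; right; apply: eq_bigl => p; first by rewrite ltnS.
  by rewrite ltnNge.
have h3 : \rsum_(1 <= p < n.*2.+1 | prime p && (n < p)%N) ln (INR p) <= ln (INR c).
  rewrite e; apply: Rle_trans (_ : \rsum_(1 <= p < n.*2.+1 | prime p) (INR (logn p c) * ln (INR p)) <= _); last first.
    apply: rsum_widen => [|p _ _]; first by rewrite ltnS leq_maxr.
    by apply: Rmult_le_pos; [exact: pos_INR|exact: ln_INR_ge0].
  apply: Rle_trans (_ : \rsum_(1 <= p < n.*2.+1 | prime p && (n < p)%N) (INR (logn p c) * ln (INR p)) <= _); last first.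
    apply: rsum_sub => p; first by case/andP.
    by move=> _; apply: Rmult_le_pos; [exact: pos_INR|exact: ln_INR_ge0].
  apply: rsum_le => p; rewrite mem_index_iota => /andP[p0 p1] /andP[hp hnp].
  rewrite -[X in X <= _]Rmult_1_l; apply: Rmult_le_compat_r; first exact: ln_INR_ge0.
  apply: INR_ge1; rewrite logn_gt0 mem_primes hp c0 /=.
  have : (p %| (n.*2)`!)%N by apply: dvdn_fact; rewrite p0 -ltnS.
  rewrite -(bin_fact hn2) Euclid_dvdM // => /orP[//|].
  have -> : (n.*2 - n = n)%N by rewrite -addnn addnK.
  by rewrite Euclid_dvdM // prime_dvd_fact.
lra.
Qed.

(** Chebyshev's bound, by halving [n] with rounding up; the constant leaves room
   for the rounding. *)
Lemma theta_le n : chebyshev_theta n <= 6 * INR n.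
Proof.
elim/ltn_ind: n => n IH.
case: (ltnP 1 n) => n1; last first.
  rewrite /chebyshev_theta big_nat_cond big1; first by have := pos_INR n; lra.
  move=> p /andP[/andP[h1 h2] hp]; exfalso; move: (prime_gt1 hp); lia.
pose m := uphalf n.
have hm : (m < n)%N by rewrite /m; lia.
have h : chebyshev_theta n <= chebyshev_theta m.*2.
  apply: rsum_widen => [|p _ _]; [rewrite /m; lia|exact: ln_INR_ge0].
have := theta_double m; have := IH _ hm.
have : INR (m.*2 + m.*2)%N <= INR (3 * n)%N by apply: INR_leq; rewrite /m; lia.
rewrite INRM -!addnn !INRD.
have -> : INR 3 = 3 by rewrite /INR; ring.
rewrite -addnn in h *. lra.
Qed.

Definition primepi (n : nat) := \rsum_(1 <= p < n.+1 | prime p) 1.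

Lemma primepi_ge0 n : 0 <= primepi n.
Proof. by apply: rsum_ge0 => i _; lra. Qed.

Lemma primepi_le_id n : primepi n <= INR n.
Proof.
rewrite /primepi rsum_const Rmult_1_r; apply: INR_leq.
by apply: leq_trans (count_size _ _) _; rewrite size_iota subn1.
Qed.

Lemma count_squares n m :
  \rsum_(1 <= k < m.+1 | (k * k <= n)%N) 1 <= sqrt (INR n).
Proof.
elim: m => [|m IH]; first by rewrite big_geq //; exact: sqrt_pos.
case: (leqP (m.+1 * m.+1) n) => h; last first.
  by rewrite big_mkcond big_nat_recr //= leqNgt h /= Rplus_0_r -big_mkcond.
apply: Rle_trans (_ : INR m.+1 <= _).
  rewrite rsum_const Rmult_1_r; apply: INR_leq.
  by apply: leq_trans (count_size _ _) _; rewrite size_iota subn1.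
rewrite -(sqrt_square (INR m.+1)); last exact: pos_INR.
by apply: sqrt_le_1_alt; rewrite -INRM; exact: INR_leq.
Qed.

Lemma ln_le_sqrt x : 0 < x -> ln x <= 2 * sqrt x.
Proof.
move=> hx; have hs := sqrt_lt_R0 _ hx.
rewrite -{1}(sqrt_sqrt x); last lra.
by rewrite ln_mult //; have := ln_le_sub1 _ hs; lra.
Qed.

Lemma sqrt_ln_le n : (0 < n)%N -> sqrt (INR n) * ln (INR n) <= 2 * INR n.
Proof.
move=> /INR_gt0 hn; have h := ln_le_sqrt _ hn; have h2 := sqrt_sqrt (INR n) (Rlt_le _ _ hn).
have := sqrt_pos (INR n); nra.
Qed.

Lemma ln_le_double_ln (n k : nat) : (0 < n)%N -> (0 < k)%N -> (n < k * k)%N ->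
  ln (INR n) <= 2 * ln (INR k).
Proof.
move=> n0 k0 h; have hk := INR_gt0 _ k0.
have -> : 2 * ln (INR k) = ln (INR (k * k)%N) by rewrite INRM ln_mult //; lra.
by apply: ln_le; [exact: INR_gt0|apply: INR_leq; exact: ltnW].
Qed.

(** Primes with [p * p <= n] number at most [sqrt n]; each of the others has
   [ln n <= 2 ln p] and is counted by the Chebyshev function. *)
Lemma primepi_le n : (0 < n)%N -> primepi n * ln (INR n) <= 14 * INR n.
Proof.
move=> n0; rewrite /primepi Rmult_comm big_distrr /=.
apply: Rle_trans (_ : \rsum_(1 <= p < n.+1 | prime p) 
  (2 * ln (INR p) + if (p * p <= n)%N then ln (INR n) else 0) <= _).
  apply: rsum_le => p _ hp; case: (leqP (p * p) n) => h.
    by have := ln_INR_ge0 p; lra.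
  by have := ln_le_double_ln _ _ n0 (prime_gt0 hp) h; lra.
rewrite big_split /= -big_distrr /= -/(chebyshev_theta n).
have := theta_le n; have := sqrt_ln_le n n0.
have : \rsum_(1 <= p < n.+1 | prime p) (if (p * p <= n)%N then ln (INR n) else 0)
   <= sqrt (INR n) * ln (INR n).
  rewrite -big_mkcondr /=.
  apply: Rle_trans (_ : \rsum_(1 <= p < n.+1 | (p * p <= n)%N) ln (INR n) <= _).
    by apply: rsum_sub => [p /andP[]|p _] //; exact: ln_INR_ge0.
  rewrite rsum_const; apply: Rmult_le_compat_r; first exact: ln_INR_ge0.
  by have := count_squares n n; rewrite rsum_const Rmult_1_r.
lra.
Qed.

Lemma ln_ratio_le_sum p X : (0 < p)%N -> (p <= X)%N ->
  ln (INR X) - ln (INR p) <= \rsum_(1 <= m < X | (p <= m)%N) / INR m.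
Proof.
move=> p0; elim: X => [|X IH] h; first by lia.
case: (ltnP X p) => hX.
  have -> : p = X.+1 by lia.
  rewrite Rminus_diag; apply: rsum_ge0 => i _; exact: inv_INR_ge0.
have hX0 : (0 < X)%N by lia.
rewrite big_mkcond big_nat_recr //= hX -big_mkcond /=.
have h1 := INR_gt0 _ hX0; have h2 := INR_gt0 X.+1 (ltn0Sn _).
have := ln_le_sub1 _ (Rdiv_lt_0_compat _ _ h2 h1).
rewrite ln_div // => h3.
have : INR X.+1 / INR X - 1 = / INR X by rewrite S_INR; field; lra.
by have := IH hX; lra.
Qed.

(** Summation by parts: the sum is at most [\sum_(m < X) pi(m) / m], and
   [pi(m) / m = O(1 / ln X)] unless [m * m <= X]. This is what makes the
   resonator at [t = 0] only as large as [exp (O(X / ln X))]. *)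
Lemma sum_ln_ratio_primes X : (1 < X)%N ->
  (\rsum_(1 <= p < X.+1 | prime p) (ln (INR X) - ln (INR p))) * ln (INR X) <= 30 * INR X.
Proof.
move=> X1; have X0 : (0 < X)%N by apply: ltnW.
have hl := ln_INR_ge0 X.
apply: Rle_trans (_ : (\rsum_(1 <= m < X) (primepi m / INR m)) * ln (INR X) <= _).
  apply: Rmult_le_compat_r => //.
  apply: Rle_trans (_ : \rsum_(1 <= p < X.+1 | prime p) \rsum_(1 <= m < X | (p <= m)%N) / INR m <= _).
    apply: rsum_le => p; rewrite mem_index_iota => /andP[h1 h2] _.
    exact: ln_ratio_le_sum.
  under eq_bigr => p _ do rewrite big_mkcond.
  rewrite exchange_big /= !big_nat; apply: rsum_le => m _ /andP[m1 m2].
  rewrite -big_mkcondr /= rsum_const /Rdiv; apply: Rmult_le_compat_r; first exact: inv_INR_ge0.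
  rewrite /primepi (big_nat_widen 1 m.+1 X.+1); last (by rewrite ltnS; exact: ltnW); rewrite rsum_const Rmult_1_r.
  by right; congr INR; apply: eq_count => p; rewrite ltnS.
rewrite Rmult_comm big_distrr /=.
apply: Rle_trans (_ : \rsum_(1 <= m < X) (28 + if (m * m <= X)%N then ln (INR X) else 0) <= _).
  rewrite !big_nat; apply: rsum_le => m _ /andP[m1 m2]; have hm := INR_gt0 _ m1.
  case: (leqP (m * m) X) => h.
    have : primepi m / INR m <= 1.
      by apply/Rle_div_l => //; have := primepi_le_id m; lra.
    by nra.
  have h1 := ln_le_double_ln _ _ X0 m1 h.
  have h2 : primepi m * ln (INR m) / INR m <= 14.
    by apply/Rle_div_l => //; have := primepi_le _ m1; lra.
  have h3 : 0 <= primepi m / INR m.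
    by apply: Rdiv_le_0_compat => //; exact: primepi_ge0.
  have : ln (INR X) * (primepi m / INR m) <= 2 * ln (INR m) * (primepi m / INR m).
    exact: Rmult_le_compat_r.
  rewrite /Rdiv in h2 *; lra.
rewrite big_split /= rsum_const count_predT size_iota.
have h1 : INR (X - 1)%N <= INR X by apply: INR_leq; rewrite leq_subr.
have : \rsum_(1 <= m < X) (if (m * m <= X)%N then ln (INR X) else 0)
   <= sqrt (INR X) * ln (INR X).
  rewrite -big_mkcond /= rsum_const; apply: Rmult_le_compat_r; first exact: ln_INR_ge0.
  have := count_squares X X.-1; rewrite rsum_const Rmult_1_r prednK //.
have := sqrt_ln_le _ X0; lra.
Qed.

(** The sum of the prime factors of [n] up to [X], with multiplicity. *)
Definition sopfr X n := \rsum_(1 <= p < X.+1 | prime p) (INR (logn p n) * INR p).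

Lemma smooth_sum_logn X p x : prime p -> (p <= X)%N ->
  \rsum_(1 <= n < x.+1 | smooth X n) (INR (logn p n) * / INR n) =
  / INR p * \rsum_(1 <= m < (x %/ p).+1 | smooth X m) ((1 + INR (logn p m)) * / INR m).
Proof.
move=> hp hpX; rewrite big_mkcond.
rewrite (eq_bigr (fun n => INR (logn p n) * (if smooth X n then / INR n else 0))); last first.
  by move=> n _; case: ifP => _; rewrite ?Rmult_0_r.
rewrite rsum_logn // [in RHS]big_mkcond big_distrr /= !big_nat.
apply: eq_bigr => m /andP[m0 _].
rewrite smoothM ?(prime_gt0 hp) // smooth_prime // hpX /=.
have hm := INR_gt0 _ m0; have hp2 := INR_prime_ge2 _ hp.
case: (smooth X m); last by lra.
by rewrite INRM Rinv_mult; lra.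
Qed.

(** With [V] the sum on the left and [S] the smooth sum, [smooth_sum_logn] gives
   [V <= (S + V) / p], hence [p V <= 2 S] since [p >= 2]. *)
Lemma smooth_sum_logn_le X p x : prime p -> (p <= X)%N ->
  INR p * \rsum_(1 <= n < x.+1 | smooth X n) (INR (logn p n) * / INR n) <=
  2 * smooth_sum X x.
Proof.
move=> hp hpX; set V := \big[_/_]_(_ <= _ < _ | _) _.
have hp2 := INR_prime_ge2 _ hp.
have hS := smooth_sum_ge0 X x.
have : V <= / INR p * (smooth_sum X x + V).
  rewrite {1}/V smooth_sum_logn //; apply: Rmult_le_compat_l; first exact: inv_INR_ge0.
  rewrite /V /smooth_sum -big_split /=.
  rewrite (eq_bigr (fun m => / INR m + INR (logn p m) * / INR m)); last by move=> m _; lra.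
  apply: rsum_widen; first by rewrite ltnS leq_div.
  move=> m _ _; have := pos_INR (logn p m); have := inv_INR_ge0 m; nra.
move=> /(Rmult_le_compat_l (INR p) _ _ ltac:(lra)).
rewrite -Rmult_assoc Rinv_r; last lra.
have : 0 <= V.
  by apply: rsum_ge0 => m _; apply: Rmult_le_pos; [exact: pos_INR|exact: inv_INR_ge0].
nra.
Qed.

Lemma smooth_sum_sopfr_le X x :
  \rsum_(1 <= n < x.+1 | smooth X n) (sopfr X n * / INR n) <=
  2 * primepi X * smooth_sum X x.
Proof.
under eq_bigr => n _ do rewrite /sopfr big_distrl.
rewrite exchange_big /=.
have -> : 2 * primepi X * smooth_sum X x =
    \rsum_(1 <= p < X.+1 | prime p) (2 * smooth_sum X x).
  by rewrite /primepi !rsum_const; lra.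
rewrite big_nat_cond [X in _ <= X]big_nat_cond.
apply: rsum_le => p _ /andP[/andP[p0 pX] hp].
rewrite (eq_bigr (fun n => INR p * (INR (logn p n) * / INR n))); last by move=> n _; lra.
rewrite -big_distrr /=.
have := smooth_sum_logn_le X p x hp pX; lra.
Qed.

(** Write [ln n] as a sum over the prime factors of [n], keep each prime only
   once, and put [n = p m]: for fixed [m], the primes [p <= min X (x/m)]
   contribute [ln (min X (x/m)) - O(1)] by Mertens. The right-hand window
   [Rmin (ln X) (ln (x/m))] is the discrete form of the delay in the Dickman
   equation. *)
Lemma smooth_sum_ln_ge X x : (0 < X)%N ->
  \rsum_(1 <= m < x.+1 | smooth X m)
     (Rmin (ln (INR X)) (ln (INR x) - ln (INR m)) - 4) * / INR m <=
  \rsum_(1 <= n < x.+1 | smooth X n) ln (INR n) * / INR n.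
Proof.
move=> X0.
have -> : \rsum_(1 <= n < x.+1 | smooth X n) ln (INR n) * / INR n =
  \rsum_(1 <= p < X.+1 | prime p) 
    ln (INR p) * (\rsum_(1 <= n < x.+1 | smooth X n) (INR (logn p n) * / INR n)).
  under [RHS]eq_bigr => p _ do rewrite big_distrr.
  rewrite exchange_big /= big_nat_cond [RHS]big_nat_cond.
  apply: eq_bigr => n /andP[/andP[n0 _] hn].
  rewrite (ln_smooth _ _ n0 hn) big_distrl /=; apply: eq_bigr => p _; lra.
apply: Rle_trans (_ : \rsum_(1 <= p < X.+1 | prime p) \rsum_(1 <= m < x.+1 | smooth X m && (p * m <= x)%N)
   (ln (INR p) / INR p * / INR m) <= _); last first.
  rewrite big_nat_cond [X in _ <= X]big_nat_cond.
  apply: rsum_le => p _ /andP[/andP[p0 pX] hp].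
  rewrite -big_distrr /= /Rdiv Rmult_assoc; apply: Rmult_le_compat_l; first exact: ln_INR_ge0.
  rewrite smooth_sum_logn //; apply: Rmult_le_compat_l; first exact: inv_INR_ge0.
  apply: Rle_trans (_ : \rsum_(1 <= m < (x %/ p).+1 | smooth X m) / INR m <= _).
    rewrite (big_nat_widen 1 (x %/ p).+1 x.+1) ?ltnS ?leq_div //.
    right; apply: eq_bigl => m; rewrite ltnS leq_divRL // mulnC //.
  apply: rsum_le => m _ _; have := pos_INR (logn p m); have := inv_INR_ge0 m; nra.
under [X in _ <= X]eq_bigr => p _ do rewrite big_mkcondr.
rewrite exchange_big /=.
rewrite big_nat_cond [X in _ <= X]big_nat_cond.
apply: rsum_le => m _ /andP[/andP[m0 mx] hm].
rewrite -big_mkcondr /= -big_distrl /=; apply: Rmult_le_compat_r; first exact: inv_INR_ge0.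
pose q := (x %/ m)%N; pose z := minn X q.
have q0 : (0 < q)%N by rewrite divn_gt0.
have z0 : (0 < z)%N by rewrite leq_min X0.
apply: Rle_trans (_ : ln (INR z) - 3 <= _); last first.
  apply: Rle_trans (mertens_lower _ z0) _.
  rewrite (big_nat_widen 1 z.+1 X.+1) ?ltnS ?geq_minl //.
  apply: rsum_sub => p.
    by rewrite ltnS leq_min leq_divRL // => /and3P[-> _ ->].
  by move=> _; apply: Rmult_le_pos; [exact: ln_INR_ge0|exact: inv_INR_ge0].
have hmR := INR_gt0 _ m0; have hqR := INR_gt0 _ q0.
have hx : ln (INR x) - ln (INR m) <= ln (INR q) + 1.
  have h : ln (INR x) <= ln (INR (2 * q * m)%N).
    apply: ln_le; first by apply: INR_gt0; lia.
    apply: INR_leq; rewrite -mulnA mul2n -addnn.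
    have := divn_eq x m; have := ltn_pmod x m0; rewrite -/q; nia.
  move: h; rewrite !INRM.
  have -> : INR 2 = 2 by rewrite /INR; ring.
  rewrite !ln_mult //; try lra.
  have := ln_le_sub1 2; lra.
rewrite /z /minn; case: ifP => _.
  by have := Rmin_l (ln (INR X)) (ln (INR x) - ln (INR m)); lra.
by have := Rmin_r (ln (INR X)) (ln (INR x) - ln (INR m)); lra.
Qed.

(** * The Dickman function *)

(** Differentiability is asked for in the interior, because [rho] has a corner at
   [1], the left end of the intervals to which this is applied. *)
Lemma eq_of_derive_zero (f : R -> R) a b : a <= b ->
  (forall x, a < x < b -> is_derive f x 0) ->
  (forall x, a <= x <= b -> continuous f x) -> f b = f a.
Proof.
move=> hab hd hc.
case: (MVT_gen f a b (fun=> 0)) => [x|x|c [_]]; rewrite ?Rmin_left ?Rmax_right //; try lra.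
- exact: hd.
- by move=> hx; apply/continuity_pt_filterlim; exact: hc.
Qed.

Lemma is_derive_RInt_cont (f : R -> R) a x : (forall t, continuous f t) ->
  is_derive (fun u => RInt f a u) x (f x).
Proof.
move=> hf; apply: is_derive_RInt (hf x).
exists (mkposreal 1 Rlt_0_1) => y _; apply: RInt_correct.
by apply: ex_RInt_continuous => z _.
Qed.

Section Dickman.
Variable rho : R -> R.
Hypothesis hrho : is_dickman rho.

(* Clamping the argument makes the function continuous on the whole line,
   whatever the values of [rho] at negative numbers. *)
Let r u := rho (Rmax 0 u).

Lemma dickman_cont x : continuous r x.
Proof.
case: hrho => hc _; rewrite /continuous /r.
have h0 : 0 <= Rmax 0 x by exact: Rmax_l.
apply: filterlim_comp (hc _ h0) => P [eps hP].
exists eps => y hy; apply: hP; last exact: Rmax_l.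
move: hy; rewrite /ball /= /AbsRing_ball /abs /minus /plus /opp /=.
rewrite /Rmax; case: Rle_dec => h1; case: Rle_dec => h2; split_Rabs; lra.
Qed.

Lemma dickman_le1 u : u <= 1 -> r u = 1.
Proof.
case: hrho => _ [h _] hu; apply: h; split; first exact: Rmax_l.
by apply: Rmax_lub; lra.
Qed.

Lemma dickman_derive u : 1 < u -> is_derive r u (- r (u - 1) / u).
Proof.
case: hrho => _ [_ h] hu; case: (h u hu) => hex hD.
apply: (is_derive_ext_loc rho).
  exists (mkposreal 1 Rlt_0_1) => y.
  rewrite /ball /= /AbsRing_ball /abs /minus /plus /opp /= => hy.
  by rewrite /r Rmax_right //; split_Rabs; lra.
have -> : - r (u - 1) / u = Derive rho u.
  rewrite /r Rmax_right; last lra.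
  apply: (Rmult_eq_reg_l u); last lra.
  by rewrite hD; field; lra.
exact: Derive_correct.
Qed.

Definition dickman_int u := RInt r 0 u.
Let F := dickman_int.

Lemma dickman_int_derive u : is_derive F u (r u).
Proof. by apply: is_derive_RInt_cont => t; exact: dickman_cont. Qed.

Lemma dickman_int_cont u : continuous F u.
Proof. by apply: ex_derive_continuous; exists (r u); exact: dickman_int_derive. Qed.

Lemma dickman_int_le1 u : u <= 1 -> F u = u.
Proof.
move=> hu; rewrite /F /dickman_int (RInt_ext _ (fun=> 1)).
  by rewrite RInt_const /scal /= /mult /=; lra.
move=> x [_ hx]; apply: dickman_le1.
by move: hx; rewrite /Rmax; case: Rle_dec; lra.
Qed.

(** Both sides have derivative [rho u - rho (u - 1)] and agree at [u = 1]. *)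
Lemma dickman_window u : 1 <= u -> u * r u = F u - F (u - 1).
Proof.
move=> hu; suff : u * r u - (F u - F (u - 1)) = 1 * r 1 - (F 1 - F (1 - 1)).
  by rewrite (dickman_le1 1) ?(dickman_int_le1 1) ?(dickman_int_le1 (1 - 1)); lra.
apply: (eq_of_derive_zero (fun u => u * r u - (F u - F (u - 1)))) => // x hx.
- have h1 := dickman_derive x ltac:(lra).
  have h2 := dickman_int_derive x; have h3 := dickman_int_derive (x - 1).
  have e : 1 * r x + x * (- r (x - 1) / x) - (r x - 1 * r (x - 1)) = 0 by field; lra.
  rewrite -e; apply: is_derive_minus.
    by apply: is_derive_mult h1 _; [exact: is_derive_id|move=> ? ?; exact: Rmult_comm].
  apply: is_derive_minus h2 _.
  apply: (is_derive_comp F (fun x => x - 1)) => //.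
  by auto_derive.
- apply: continuous_minus; first by apply: continuous_mult (dickman_cont x); exact: continuous_id.
  apply: continuous_minus (dickman_int_cont x) _.
  apply: continuous_comp (dickman_int_cont _).
  by apply: continuous_minus; [exact: continuous_id|exact: continuous_const].
Qed.

Lemma dickman_int_diff a b : F b - F a = RInt r a b.
Proof.
have ex c d : ex_RInt r c d by apply: ex_RInt_continuous => z _; exact: dickman_cont.
by rewrite /F /dickman_int -(RInt_Chasles r 0 a b) // /plus /=; lra.
Qed.

(** Let [c > 1] be a minimum point of [rho] on [[0, b]]. Then
   [c rho(c) = \int_(c-1)^c rho >= rho(c)], so [rho(c) >= 0]. The same equation
   at a maximum point gives [rho(c) <= 0] unless [c <= 1]. *)
Lemma dickman_bounds u : 0 <= r u <= 1.
Proof.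
have hc x : 0 <= x <= Rmax 1 u -> continuity_pt r x.
  by move=> _; apply/continuity_pt_filterlim; exact: dickman_cont.
have hb : 0 <= Rmax 1 u by have := Rmax_l 1 u; lra.
have hu : u <= Rmax 1 u by exact: Rmax_r.
have hru : r u = r (Rmax 0 u) by rewrite /r; congr rho; rewrite /Rmax; repeat case: Rle_dec; lra.
have h0u : 0 <= Rmax 0 u <= Rmax 1 u.
  by rewrite /Rmax; repeat case: Rle_dec; lra.
have ex a b : ex_RInt r a b by apply: ex_RInt_continuous => z _; exact: dickman_cont.
have ec (k c : R) : RInt (fun=> k) (c - 1) c = k.
  by rewrite RInt_const /scal /= /mult /=; ring.
split.
- have [c [hm hcb]] := continuity_ab_min r 0 (Rmax 1 u) hb hc.
  apply: Rle_trans (_ : r c <= _); last by rewrite hru; exact: hm.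
  case: (Rle_dec c 1) => h1; first by rewrite dickman_le1 //; lra.
  have := dickman_window c ltac:(lra); rewrite dickman_int_diff.
  have : RInt (fun=> r c) (c - 1) c <= RInt r (c - 1) c.
    by apply: RInt_le => //; [lra|exact: ex_RInt_const|move=> x hx; apply: hm; lra].
  by rewrite ec; nra.
- have [c [hm hcb]] := continuity_ab_maj r 0 (Rmax 1 u) hb hc.
  apply: Rle_trans (_ : r c <= _); first by rewrite hru; exact: hm.
  case: (Rle_dec c 1) => h1; first by rewrite dickman_le1 //; lra.
  have := dickman_window c ltac:(lra); rewrite dickman_int_diff.
  have : RInt r (c - 1) c <= RInt (fun=> r c) (c - 1) c.
    by apply: RInt_le => //; [lra|exact: ex_RInt_const|move=> x hx; apply: hm; lra].
  by rewrite ec; nra.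
Qed.

Lemma ex_RInt_dickman_int a b : ex_RInt F a b.
Proof. by apply: ex_RInt_continuous => z _; exact: dickman_int_cont. Qed.

(** Integrating [u rho(u) = F(u) - F(u - 1)] gives this equation for the primitive
   [F]; the smooth sum satisfies the same one, as an inequality and up to a
   relative error [O(1 / ln X)]. *)
Lemma dickman_int_eq u : 1 <= u -> u * F u = RInt F 0 u + RInt F (u - 1) u.
Proof.
move=> hu.
pose P v := RInt F 0 v.
have dP v : is_derive P v (F v) by apply: is_derive_RInt_cont => t; exact: dickman_int_cont.
have cP v : continuous P v by apply: ex_derive_continuous; exists (F v).
have -> : RInt F (u - 1) u = P u - P (u - 1).
  rewrite /P -(RInt_Chasles F 0 (u - 1) u); try exact: ex_RInt_dickman_int.
  by rewrite /plus /=; lra.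
have P1 : P 1 = 1 / 2.
  apply: is_RInt_unique.
  apply: (is_RInt_ext (fun x => x)).
    by move=> x; rewrite Rmin_left ?Rmax_right; try lra; move=> hx; rewrite dickman_int_le1; lra.
  have := is_RInt_derive (fun x => x * x / 2) (fun x => x) 0 1.
  have -> : minus (1 * 1 / 2) (0 * 0 / 2) = 1 / 2 by rewrite /minus /plus /opp /=; lra.
  apply => x _; first by auto_derive => //; lra.
  exact: continuous_id.
have P0 : P (1 - 1) = 0.
  by rewrite /P Rminus_diag RInt_point.
change (u * F u = P u + (P u - P (u - 1))).
suff : u * F u - 2 * P u + P (u - 1) = 1 * F 1 - 2 * P 1 + P (1 - 1).
  by rewrite P1 P0 (dickman_int_le1 1); lra.
apply: (eq_of_derive_zero (fun u => u * F u - 2 * P u + P (u - 1))) => // x hx.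
- have e : (1 * F x + x * r x) - 2 * F x + 1 * F (x - 1) = 0.
    by rewrite (dickman_window x); lra.
  rewrite -e; apply: is_derive_plus.
    apply: is_derive_minus.
      by apply: is_derive_mult (dickman_int_derive x) _; [exact: is_derive_id|move=> ? ?; exact: Rmult_comm].
    exact: (is_derive_scal P).
  apply: (is_derive_comp P (fun x => x - 1)) => //.
  by auto_derive.
- apply: continuous_plus.
    apply: continuous_minus.
      by apply: continuous_mult (dickman_int_cont x); exact: continuous_id.
    by apply: continuous_mult => //; exact: continuous_const.
  apply: continuous_comp (cP _).
  by apply: continuous_minus; [exact: continuous_id|exact: continuous_const].
Qed.

Lemma dickman_int_mono a b : a <= b -> F a <= F b.
Proof.
move=> hab; suff : 0 <= F b - F a by lra.
rewrite dickman_int_diff; apply: RInt_ge_0 => //.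
  by apply: ex_RInt_continuous => z _; exact: dickman_cont.
by move=> x _; case: (dickman_bounds x).
Qed.

Lemma dickman_int_lip a b : a <= b -> F b - F a <= b - a.
Proof.
move=> hab; rewrite dickman_int_diff.
apply: Rle_trans (_ : RInt (fun=> 1) a b <= _).
  apply: RInt_le => //; [|exact: ex_RInt_const|].
  - by apply: ex_RInt_continuous => z _; exact: dickman_cont.
  - by move=> x _; case: (dickman_bounds x).
by rewrite RInt_const /scal /= /mult /=; lra.
Qed.

Lemma dickman_int_le u : 0 <= u -> F u <= u.
Proof. by move=> /dickman_int_lip; rewrite (dickman_int_le1 0); lra. Qed.

Lemma dickman_int_RInt u : 0 <= u -> RInt rho 0 u = F u.
Proof.
move=> hu; apply: RInt_ext => x; rewrite Rmin_left // => hx.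
by rewrite /r Rmax_right; lra.
Qed.
End Dickman.

(** * Sums over smooth numbers against the Dickman function *)

Definition step (a u : R) : R := if Rle_dec a u then 1 else 0.

Lemma is_RInt_step a b c : b <= c ->
  is_RInt (step a) b c (Rmax 0 (c - a) - Rmax 0 (b - a)).
Proof.
have const k b' c' : b' <= c' -> (forall x, b' < x < c' -> step a x = k) ->
    is_RInt (step a) b' c' ((c' - b') * k).
  move=> h hk; apply: (is_RInt_ext (fun=> k)); last exact: is_RInt_const.
  by rewrite Rmin_left ?Rmax_right // => x hx; rewrite hk.
have s1 x : a < x -> step a x = 1 by rewrite /step => h; case: Rle_dec => //= h2; lra.
have s0 x : x < a -> step a x = 0 by rewrite /step => h; case: Rle_dec => //= h2; lra.
move=> hbc; case: (Rle_lt_dec a b) => hab.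
  rewrite !Rmax_right; try lra.
  have -> : c - a - (b - a) = (c - b) * 1 by lra.
  by apply: const => // x hx; apply: s1; lra.
case: (Rle_lt_dec a c) => hac; last first.
  rewrite !Rmax_left; try lra.
  have -> : 0 - 0 = (c - b) * 0 by lra.
  by apply: const => // x hx; apply: s0; lra.
rewrite Rmax_right; last lra; rewrite Rmax_left; last lra.
have -> : c - a - 0 = plus ((a - b) * 0) ((c - a) * 1) by rewrite /plus /=; lra.
apply: (is_RInt_Chasles _ _ a).
  by apply: const => [|x hx]; [lra|apply: s0; lra].
by apply: const => // x hx; apply: s1; lra.
Qed.

Lemma is_RInt_rsum (I : Type) (s : seq I) (P : pred I) (f : I -> R -> R) (l : I -> R) a b :
  (forall i, P i -> is_RInt (f i) a b (l i)) ->
  is_RInt (fun x => \big[Rplus/0]_(i <- s | P i) f i x) a b (\big[Rplus/0]_(i <- s | P i) l i).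
Proof.
move=> h; elim: s => [|i s IH].
  rewrite big_nil; apply: (is_RInt_ext (fun=> 0)) => [x _|]; first by rewrite big_nil.
  have := is_RInt_const a b 0; by rewrite /scal /= /mult /= Rmult_0_r.
rewrite big_cons; case hP: (P i); last first.
  by apply: is_RInt_ext IH => x _; rewrite big_cons hP.
apply: (is_RInt_ext (fun x => plus (f i x) (\big[Rplus/0]_(i <- s | P i) f i x))).
  by move=> x _; rewrite big_cons hP.
by apply: is_RInt_plus IH; exact: h.
Qed.

Section SmoothProfile.
Variables (X M : nat).
Hypothesis X1 : (1 < X)%N.
Let Y := ln (INR X).

(** The sum of [1/n] over [X]-smooth [n <= X^u], divided by [ln X]. It is written
   as a finite combination of jumps, cut off at [n <= M], so that its integrals
   are explicit. *)
Definition profile (u : R) : R :=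
  \rsum_(1 <= n < M.+1 | smooth X n) (step (ln (INR n) / ln (INR X)) u * (/ INR n / ln (INR X))).
Let g := profile.

Lemma ln2_ge : 1 / 2 <= ln 2.
Proof.
have := ln_le_sub1 (/ 2) ltac:(lra); rewrite ln_Rinv; lra.
Qed.

Lemma lnX_ge : 1 / 2 <= Y.
Proof.
apply: Rle_trans ln2_ge _; apply: ln_le; first lra.
by have := INR_leq _ _ X1; rewrite S_INR INR1; lra.
Qed.

Lemma is_RInt_profile b c : b <= c ->
  is_RInt g b c (\rsum_(1 <= n < M.+1 | smooth X n)
    ((Rmax 0 (c - ln (INR n) / Y) - Rmax 0 (b - ln (INR n) / Y)) * (/ INR n / Y))).
Proof.
move=> hbc; apply: is_RInt_rsum => n _.
apply: (is_RInt_ext (fun u => scal (/ INR n / Y) (step (ln (INR n) / Y) u))).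
  by move=> x _; rewrite /scal /= /mult /=; rewrite Rmult_comm.
rewrite Rmult_comm; apply: (is_RInt_scal (step _)); exact: is_RInt_step.
Qed.

Lemma profileE u x : (x <= M)%N -> INR x <= exp (u * Y) < INR x.+1 ->
  forall n, (0 < n)%N -> step (ln (INR n) / Y) u = if (n <= x)%N then 1 else 0.
Proof.
move=> hxM [h1 h2] n n0; have hn := INR_gt0 _ n0; have hY := lnX_ge.
rewrite /step; case: Rle_dec => h; case: leqP => hx //; exfalso.
- have h3 : INR x.+1 <= INR n by apply: INR_leq.
  have : ln (INR n) <= u * Y.
    by apply/Rle_div_l; [lra|exact: h].
  have := ln_increasing _ _ (exp_pos _) h2; rewrite ln_exp.
  have := ln_le _ _ (INR_gt0 _ (ltn0Sn x)) h3; lra.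
- apply: h; apply/Rle_div_l; first lra.
  rewrite -(ln_exp (u * Y)); apply: ln_le => //.
  by have := INR_leq _ _ hx; lra.
Qed.

Lemma profile_sum u x (f : nat -> R) : (x <= M)%N -> INR x <= exp (u * Y) < INR x.+1 ->
  (forall n, u < ln (INR n) / Y -> f n = 0) ->
  \rsum_(1 <= n < M.+1 | smooth X n) f n = \rsum_(1 <= n < x.+1 | smooth X n) f n.
Proof.
move=> hxM hx hf.
rewrite [RHS](big_nat_widen 1 x.+1 M.+1) ?ltnS // [RHS]big_mkcondr /=.
rewrite big_nat_cond [RHS]big_nat_cond; apply: eq_bigr => n /andP[/andP[n0 _] _].
have := profileE u x hxM hx n n0; rewrite ltnS /step.
case: Rle_dec => /= h; case: leqP => // _ e; try lra.
by rewrite hf //; lra.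
Qed.

Lemma profile_val u x : (x <= M)%N -> INR x <= exp (u * Y) < INR x.+1 ->
  g u = smooth_sum X x / Y.
Proof.
move=> hxM hx; rewrite /g /profile (profile_sum u x) //; last first.
  by move=> n hn; rewrite -/Y /step; case: Rle_dec => /= h; lra.
rewrite -/Y /smooth_sum {2 3}/Rdiv big_distrl /= big_nat_cond [RHS]big_nat_cond.
apply: eq_bigr => n /andP[/andP[n0 nx] _].
by rewrite (profileE u x) // -ltnS nx; lra.
Qed.

(** Since [\int_0^u] of the jump at [a <= u] is [u - a], and its integral over
   [[u - 1, u]] is [min 1 (u - a)], this is [smooth_sum_ln_ge] in the scaled
   variable. The loss [5] is the [4] of that lemma plus the rounding of [X^u]
   to an integer. *)
Lemma profile_recurrence u x : (x <= M)%N -> INR x <= exp (u * Y) < INR x.+1 -> 1 <= u ->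
  RInt g 0 u + RInt g (u - 1) u - 5 / Y * g u <= u * g u.
Proof.
move=> hxM hx hu; have hY := lnX_ge.
have x0 : (0 < x)%N.
  case: posnP hx => // -> [_]; rewrite INR1.
  have : 0 <= u * Y by nra.
  by have := exp_ineq1_le (u * Y); lra.
have hxu : u * Y <= ln (INR x) + 1.
  rewrite -(ln_exp (u * Y)).
  apply: Rle_trans (_ : ln (INR x * 2) <= _).
    apply: ln_le; first exact: exp_pos.
    by have := INR_ge1 _ x0; case: hx => _; rewrite S_INR; lra.
  rewrite ln_mult; [|exact: INR_gt0|lra]; have := ln_le_sub1 2; lra.
rewrite (is_RInt_unique _ _ _ _ (is_RInt_profile 0 u ltac:(lra))).
rewrite (is_RInt_unique _ _ _ _ (is_RInt_profile (u - 1) u ltac:(lra))).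
have hz n : 0 <= ln (INR n) / Y by apply: Rdiv_le_0_compat; [exact: ln_INR_ge0|lra].
rewrite !(profile_sum u x) //; try by move=> n hn; have := hz n; rewrite !Rmax_left; try lra.
rewrite (profile_val u x) //.
have hle : forall n, (0 < n < x.+1)%N -> ln (INR n) / Y <= u.
  move=> n /andP[n0 nx]; have := profileE u x hxM hx n n0; rewrite -ltnS nx /step.
  by case: Rle_dec => //= _; lra.
have hsum : \rsum_(1 <= m < x.+1 | smooth X m)
     (Rmin Y (u * Y - ln (INR m)) - 5) * / INR m <=
  \rsum_(1 <= n < x.+1 | smooth X n) ln (INR n) * / INR n.
  apply: Rle_trans (smooth_sum_ln_ge X x (ltnW X1)).
  apply: rsum_le => m _ _; apply: Rmult_le_compat_r; first exact: inv_INR_ge0.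
  rewrite -/Y /Rmin; repeat case: Rle_dec; lra.
rewrite /smooth_sum.
set L := \big[_/_]_(1 <= n < x.+1 | smooth X n) (ln (INR n) * / INR n) in hsum.
set S := \big[_/_]_(1 <= n < x.+1 | smooth X n) / INR n.
pose W := \big[Rplus/0]_(1 <= n < x.+1 | smooth X n) (Rmin Y (u * Y - ln (INR n)) * / INR n).
have eW : \rsum_(1 <= m < x.+1 | smooth X m)
     (Rmin Y (u * Y - ln (INR m)) - 5) * / INR m = W - 5 * S.
  rewrite /W /S big_distrr -rsum_minus /=; apply: eq_bigr => n _; lra.
have -> : \rsum_(1 <= n < x.+1 | smooth X n) ((Rmax 0 (u - ln (INR n) / Y) - 
     Rmax 0 (0 - ln (INR n) / Y)) * (/ INR n / Y)) = u * (S / Y) - L / (Y * Y).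
  rewrite /Rdiv /S /L !big_distrl big_distrr -rsum_minus /= big_nat_cond [RHS]big_nat_cond.
  apply: eq_bigr => n /andP[hn _]; have := hz n; have := hle n hn => h1 h2.
  rewrite Rmax_right; last lra; rewrite Rmax_left; last (rewrite -/(Rdiv _ _); lra).
  by rewrite Rinv_mult; lra.
have -> : \rsum_(1 <= n < x.+1 | smooth X n) ((Rmax 0 (u - ln (INR n) / Y) - 
     Rmax 0 (u - 1 - ln (INR n) / Y)) * (/ INR n / Y)) = W / (Y * Y).
  rewrite /Rdiv /W big_distrl big_nat_cond [RHS]big_nat_cond.
  apply: eq_bigr => n /andP[hn _]; have := hz n; have := hle n hn => h1 h2.
  set a := ln (INR n) in h1 h2 *.
  have -> : Rmin Y (u * Y - a) = Y * Rmin 1 (u - a / Y).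
    have ea : a = Y * (a / Y) by field; lra.
    rewrite {1}ea; set b := a / Y.
    rewrite /Rmin; case: Rle_dec => h3; case: Rle_dec => h4; nra.
  rewrite -/(Rdiv a Y) Rmax_right; last lra.
  have -> : u - a / Y - Rmax 0 (u - 1 - a / Y) = Rmin 1 (u - a / Y).
    by rewrite /Rmax /Rmin; repeat case: Rle_dec; lra.
  have hn0 : 0 < INR n by apply: INR_gt0; case/andP: hn.
  by rewrite /=; field; lra.
rewrite eW in hsum.
have : (W - 5 * S) / (Y * Y) <= L / (Y * Y).
  apply: Rmult_le_compat_r => //; apply: Rlt_le; apply: Rinv_0_lt_compat; nra.
have -> : (W - 5 * S) / (Y * Y) = W / (Y * Y) - 5 / Y * (S / Y) by field; lra.
lra.
Qed.
End SmoothProfile.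

Lemma floor_nat a : 0 <= a -> exists x : nat, INR x <= a < INR x.+1.
Proof. by move=> /nfloor_ex[x hx]; exists x; rewrite S_INR. Qed.

Lemma RInt_exp3 s a b : 
  is_RInt (fun t => s * exp (3 * t)) a b (s * exp (3 * b) / 3 - s * exp (3 * a) / 3).
Proof.
apply: (is_RInt_derive (fun t => s * exp (3 * t) / 3)) => x _.
  by auto_derive => //; field.
apply: continuous_scal_r; apply: ex_derive_continuous; by auto_derive.
Qed.

(** A Gronwall argument for functions that need not be continuous: the supremum
   [s] of [f / phi] satisfies [s <= 2/3 s + K] when it is positive. *)
Lemma contraction_bound (f phi : R -> R) U c K : 0 <= U -> 0 <= K -> 0 <= c ->
  (forall u, 0 < phi u) ->
  (forall u, 0 <= u <= U -> f u <= c * phi u) ->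
  (forall s, 0 <= s -> (forall u, 0 <= u <= U -> f u <= s * phi u) ->
    forall u, 0 <= u <= U -> f u <= (2 / 3 * s + K) * phi u) ->
  forall u, 0 <= u <= U -> f u <= 3 * K * phi u.
Proof.
move=> hU hK hc hphi hb hstep.
pose E s := exists2 u, 0 <= u <= U & s = f u / phi u.
have [||m [hm1 hm2]] := completeness E.
- exists c => _ [u hu ->]; apply/Rle_div_l; [exact: hphi|exact: hb].
- by exists (f 0 / phi 0), 0 => //; lra.
pose s := Rmax 0 m.
have hs : forall u, 0 <= u <= U -> f u <= s * phi u.
  move=> u hu; apply/Rle_div_l; first exact: hphi.
  apply: Rle_trans (Rmax_r _ _); apply: hm1; by exists u.
have s0 : 0 <= s by exact: Rmax_l.
have h := hstep s s0 hs.
have : m <= 2 / 3 * s + K.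
  apply: hm2 => _ [u hu ->]; apply/Rle_div_l; [exact: hphi|exact: h].
move=> hm u hu; apply: Rle_trans (hs u hu) _.
apply: Rmult_le_compat_r; first exact: Rlt_le.
by move: hm; rewrite /s /Rmax; case: Rle_dec; lra.
Qed.

Section Lower.
Variable rho : R -> R.
Hypothesis hrho : is_dickman rho.
Let F := dickman_int rho.

(** The deficit [D = F - g] of the profile [g] is nonpositive for [u <= 1], where
   the smooth sum is a harmonic sum, and for [u >= 1] it satisfies
   [u D(u) <= \int_0^u D + \int_(u-1)^u D + O(u / ln X)]. Against the weight
   [exp (3 u)] each integral contributes at most a third of the supremum, so
   the contraction factor is [2/3]. *)
Lemma smooth_sum_lower X N : (1 < X)%N -> (0 < N)%N ->
  ln (INR X) * F (ln (INR N) / ln (INR X)) <=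
  smooth_sum X N + 45 * exp (3 * (ln (INR N) / ln (INR X))).
Proof.
move=> X1 N0; have hY := lnX_ge X X1; set Y := ln (INR X) in hY *.
pose U := ln (INR N) / Y; rewrite -/U.
have hN := INR_gt0 _ N0.
have hUY : U * Y = ln (INR N) by rewrite /U; field; lra.
have U0 : 0 <= U by apply: Rdiv_le_0_compat; [exact: ln_INR_ge0|lra].
pose g := profile X N.
have hfl u : 0 <= u <= U -> exists2 x, (0 < x <= N)%N & INR x <= exp (u * Y) < INR x.+1.
  move=> hu; have [x hx] := floor_nat _ (Rlt_le _ _ (exp_pos (u * Y))).
  exists x => //; apply/andP; split.
    case: posnP hx => // ->; rewrite INR1 => hx.
    have : 0 <= u * Y by nra.
    by have := exp_ineq1_le (u * Y); lra.
  rewrite leqNgt; apply/negP => /INR_leq; rewrite S_INR => h.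
  have : exp (u * Y) <= INR N.
    by rewrite -(exp_ln (INR N)) // -hUY; apply: exp_le; apply: Rmult_le_compat_r; lra.
  lra.
have gub u : 0 <= u <= U -> g u <= u + / Y.
  move=> hu; have [x /andP[x0 xN] hx] := hfl u hu.
  rewrite /g (profile_val X N X1 u x) // -/Y.
  apply/Rle_div_l; first lra.
  rewrite Rmult_plus_distr_r Rinv_l; last lra.
  apply: Rle_trans (smooth_sum_le X x) _; apply: Rle_trans (harmonic_le x x0) _.
  have : ln (INR x) <= u * Y.
    by rewrite -(ln_exp (u * Y)); apply: ln_le; [exact: INR_gt0|lra].
  lra.
have gpos u : 0 <= g u.
  apply: rsum_ge0 => n _; apply: Rmult_le_pos.
    by rewrite /step; case: Rle_dec => /= h; lra.
  by apply: Rdiv_le_0_compat; [exact: inv_INR_ge0|rewrite -/Y; lra].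
have small u : 0 <= u <= U -> u <= 1 -> F u - g u <= 0.
  move=> hu u1; have [x /andP[x0 xN] hx] := hfl u hu.
  rewrite /g (profile_val X N X1 u x) // -/Y /F dickman_int_le1 //.
  rewrite smooth_sum_small; last first.
    rewrite leqNgt; apply/negP => /INR_leq; rewrite S_INR => h.
    have : exp (u * Y) <= INR X.
      rewrite -(exp_ln (INR X)); last by apply: INR_gt0; exact: ltnW.
      by apply: exp_le; rewrite -/Y; nra.
    lra.
  suff : u <= harmonic x / Y by lra.
  apply/Rle_div_r; first lra.
  apply: Rle_trans (harmonic_ge x).
  by rewrite -(ln_exp (u * Y)); apply: ln_le; [exact: exp_pos|lra].
have exF a b : ex_RInt F a b by exact: ex_RInt_dickman_int.
have exg a b : a <= b -> ex_RInt g a b.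
  by move=> hab; eexists; apply: is_RInt_profile.
have hY2 : / Y <= 2.
  by rewrite -(Rinv_inv 2); apply: Rinv_le_contravar; lra.
have iY : 0 < / Y by apply: Rinv_0_lt_compat; lra.
have main := contraction_bound (fun u => F u - g u) (fun u => exp (3 * u)) U U (15 / Y) U0.
have {}main : F U - g U <= 3 * (15 / Y) * exp (3 * U).
  apply: main => //; try lra.
  - by move=> u; exact: exp_pos.
  - move=> u hu; have := gpos u; have := dickman_int_le rho hrho u ltac:(lra); rewrite -/F.
    have : 1 <= exp (3 * u) by have := exp_ineq1_le (3 * u); lra.
    nra.
  move=> s s0 hs u hu.
  have e1 : 1 <= exp (3 * u) by have := exp_ineq1_le (3 * u); lra.
  have K0 : 0 <= 15 / Y by rewrite /Rdiv; lra.
  case: (Rle_dec u 1) => u1.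
    have := small u hu u1; have : 0 <= (2 / 3 * s + 15 / Y) * exp (3 * u) by nra.
    lra.
  have u1' : 1 <= u by lra.
  have hint a b : 0 <= a -> a <= b -> b <= u ->
      RInt F a b - RInt g a b <= s * exp (3 * u) / 3.
    move=> ha hab hbu; rewrite -[_ - _]/(minus (RInt F a b) (RInt g a b)) -RInt_minus //; last exact: exg.
    apply: Rle_trans (_ : s * exp (3 * b) / 3 - s * exp (3 * a) / 3 <= _).
      rewrite -(is_RInt_unique _ _ _ _ (RInt_exp3 s a b)).
      apply: RInt_le => //.
      - by apply: ex_RInt_minus => //; exact: exg.
      - by eexists; exact: RInt_exp3.
      - by move=> x hx; apply: hs; lra.
    have : exp (3 * b) <= exp (3 * u) by apply: exp_le; lra.
    have := exp_pos (3 * a); nra.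
  have [x /andP[x0 xN] hx] := hfl u hu.
  have h1 := dickman_int_eq rho hrho u u1'; rewrite -/F in h1.
  have h2 := profile_recurrence X N X1 u x xN hx u1'; rewrite -/g -/Y in h2.
  have h3 := hint 0 u ltac:(lra) ltac:(lra) ltac:(lra).
  have h4 := hint (u - 1) u ltac:(lra) ltac:(lra) ltac:(lra).
  have h5 : 5 / Y * g u <= 15 / Y * u.
    have : g u <= 3 * u by have := gub u hu; lra.
    by rewrite /Rdiv => ?; nra.
  have h6 : u * (F u - g u) <= u * (2 / 3 * s * exp (3 * u) + 15 / Y * exp (3 * u)).
    apply: Rle_trans (_ : 2 / 3 * s * exp (3 * u) + 15 / Y * u <= _); first lra.
    have : 0 <= 2 / 3 * s * exp (3 * u) by nra.
    have : 15 / Y <= 15 / Y * exp (3 * u) by nra.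
    nra.
  rewrite Rmult_plus_distr_r.
  by apply: Rmult_le_reg_l h6; lra.
have gU : g U = smooth_sum X N / Y.
  by rewrite /g (profile_val X N X1 U N) // hUY exp_ln // S_INR; lra.
rewrite gU in main.
have : Y * (F U - smooth_sum X N / Y) <= Y * (3 * (15 / Y) * exp (3 * U)).
  by apply: Rmult_le_compat_l; lra.
have -> : Y * (F U - smooth_sum X N / Y) = Y * F U - smooth_sum X N by field; lra.
have -> : Y * (3 * (15 / Y) * exp (3 * U)) = 45 * exp (3 * U) by field; lra.
lra.
Qed.
End Lower.

(** * Positivity of averages *)

Definition ei (x : R) : C := (cos x, sin x).

Lemma eiD x y : ei (x + y) = (ei x * ei y)%C.
Proof. by rewrite /ei /Cmult /= cos_plus sin_plus; congr pair; lra. Qed.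

Lemma ei0 : ei 0 = RtoC 1.
Proof. by rewrite /ei cos_0 sin_0. Qed.

Lemma Cmod_ei x : Cmod (ei x) = 1.
Proof.
rewrite /Cmod /ei /=; have -> : cos x * (cos x * 1) + sin x * (sin x * 1) = 1.
  by have := sin2_cos2 x; rewrite /Rsqr; lra.
exact: sqrt_1.
Qed.

Section Resonance.
Variable K : nat.

(** The sum runs over the differences [j - l] with [j, l < K], because then
   it takes [ei (w t)] to a squared modulus, which is nonnegative. *)
Definition re_pair_sum (g : R -> C) : R :=
  \rsum_(0 <= j < K) \rsum_(0 <= l < K) Re (g (INR j - INR l)).

Lemma re_pair_sum_ext f g : (forall t, f t = g t) -> re_pair_sum f = re_pair_sum g.
Proof. by move=> h; apply: eq_bigr => j _; apply: eq_bigr => l _; rewrite h. Qed.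

Lemma re_pair_sum_add f g : re_pair_sum (fun t => f t + g t)%C = re_pair_sum f + re_pair_sum g.
Proof.
rewrite /re_pair_sum -big_split /=; apply: eq_bigr => j _; rewrite -big_split /=.
by apply: eq_bigr => l _.
Qed.

Lemma re_pair_sum_scal c f : re_pair_sum (fun t => RtoC c * f t)%C = c * re_pair_sum f.
Proof.
rewrite /re_pair_sum big_distrr /=; apply: eq_bigr => j _; rewrite big_distrr /=.
by apply: eq_bigr => l _; rewrite /Re /=; ring.
Qed.

Definition positive_definite (g : R -> C) : Prop :=
  forall w, 0 <= re_pair_sum (fun t => ei (w * t) * g t)%C.

(** Defining the class by its action on [positive_definite] functions makes it
   closed under products by definition; a direct proof for products would
   need a Schur product theorem. *)
Definition positivity_preserving (f : R -> C) : Prop :=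
  forall g, positive_definite g -> positive_definite (fun t => f t * g t)%C.

Lemma positive_definite_one : positive_definite (fun=> RtoC 1).
Proof.
move=> w.
have -> : re_pair_sum (fun t => ei (w * t) * RtoC 1)%C =
  (\rsum_(0 <= j < K) cos (w * INR j)) * (\rsum_(0 <= j < K) cos (w * INR j)) +
  (\rsum_(0 <= j < K) sin (w * INR j)) * (\rsum_(0 <= j < K) sin (w * INR j)).
  rewrite !big_distrl -big_split /=; apply: eq_bigr => j _.
  rewrite !big_distrr -big_split /=; apply: eq_bigr => l _.
  by rewrite Rmult_minus_distr_l cos_minus /=; lra.
nra.
Qed.

Lemma preserving_ext f g : (forall t, f t = g t) ->
  positivity_preserving f -> positivity_preserving g.
Proof.
move=> e h k hk w; rewrite (re_pair_sum_ext _ (fun t => ei (w * t) * (f t * k t))%C); first exact: h.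
by move=> t; rewrite e.
Qed.

Lemma preserving_one : positivity_preserving (fun=> RtoC 1).
Proof.
move=> g hg w; rewrite (re_pair_sum_ext _ (fun t => ei (w * t) * g t)%C); first exact: hg.
by move=> t; ring.
Qed.

Lemma preserving_ei v : positivity_preserving (fun t => ei (v * t)).
Proof.
move=> g hg w; rewrite (re_pair_sum_ext _ (fun t => ei ((w + v) * t) * g t)%C); first exact: hg.
by move=> t; rewrite Rmult_plus_distr_r eiD; ring.
Qed.

Lemma preserving_mul f1 f2 : positivity_preserving f1 -> positivity_preserving f2 ->
  positivity_preserving (fun t => f1 t * f2 t)%C.
Proof.
move=> h1 h2 g hg w; rewrite (re_pair_sum_ext _ (fun t => ei (w * t) * (f1 t * (f2 t * g t)))%C).
  by apply: h1; apply: h2.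
by move=> t; ring.
Qed.

Lemma preserving_add f1 f2 : positivity_preserving f1 -> positivity_preserving f2 ->
  positivity_preserving (fun t => f1 t + f2 t)%C.
Proof.
move=> h1 h2 g hg w.
rewrite (re_pair_sum_ext _ (fun t => ei (w * t) * (f1 t * g t) + ei (w * t) * (f2 t * g t))%C).
  by rewrite re_pair_sum_add; apply: Rplus_le_le_0_compat; [exact: h1|exact: h2].
by move=> t; ring.
Qed.

Lemma preserving_scal c f : 0 <= c -> positivity_preserving f ->
  positivity_preserving (fun t => RtoC c * f t)%C.
Proof.
move=> hc h g hg w.
rewrite (re_pair_sum_ext _ (fun t => RtoC c * (ei (w * t) * (f t * g t)))%C).
  by rewrite re_pair_sum_scal; apply: Rmult_le_pos => //; exact: h.
by move=> t; ring.
Qed.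

Lemma one_minus_ei_neq0 q x : 0 <= q < 1 -> (1 - RtoC q * ei x)%C <> 0%C.
Proof.
move=> hq /(f_equal fst) /= h; have := COS_bound x; nra.
Qed.

(** With [h = 1 / (1 - q ei(v t))], the identity [h = 1 + q ei(v t) h] bounds
   the average of [ei(w t) h g] below by [q] times the one at frequency
   [w + v]. The averages are bounded uniformly in [w], so iterating and letting
   [q ^ m] tend to [0] shows that none is negative. *)
Lemma preserving_geom q v : 0 <= q < 1 ->
  positivity_preserving (fun t => / (1 - RtoC q * ei (v * t)))%C.
Proof.
move=> hq g hg.
pose h t := (/ (1 - RtoC q * ei (v * t)) * g t)%C.
pose B := \rsum_(0 <= j < K) \rsum_(0 <= l < K) Cmod (h (INR j - INR l)).
have B0 : 0 <= B by apply: rsum_ge0 => j _; apply: rsum_ge0 => l _; exact: Cmod_ge_0.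
have hstep w : q * re_pair_sum (fun t => ei ((w + v) * t) * h t)%C <= re_pair_sum (fun t => ei (w * t) * h t)%C.
  rewrite (re_pair_sum_ext (fun t => ei (w * t) * h t)%C
     (fun t => ei (w * t) * g t + RtoC q * (ei ((w + v) * t) * h t))%C).
    by rewrite re_pair_sum_add re_pair_sum_scal; have := hg w; lra.
  move=> t; rewrite /h Rmult_plus_distr_r eiD; field.
  exact: one_minus_ei_neq0.
have hbase w : - B <= re_pair_sum (fun t => ei (w * t) * h t)%C.
  rewrite /B -!rsum_opp; apply: rsum_le => j _ _; rewrite -rsum_opp; apply: rsum_le => l _ _.
  set z := h _; have := Rmax_Cmod (ei (w * (INR j - INR l)) * z)%C.
  rewrite Cmod_mult Cmod_ei Rmult_1_l => hm.
  have := Rmax_l (Rabs (fst (ei (w * (INR j - INR l)) * z)%C)) (Rabs (snd (ei (w * (INR j - INR l)) * z)%C)).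
  rewrite /Re; move=> h1; move: (Rle_trans _ _ _ h1 hm).
  by have := Rle_abs (- fst (ei (w * (INR j - INR l)) * z)%C); rewrite Rabs_Ropp; lra.
have hpow m : forall w, - (q ^ m * B) <= re_pair_sum (fun t => ei (w * t) * h t)%C.
  elim: m => [|m IH] w; first by have := hbase w; rewrite /=; lra.
  apply: Rle_trans (hstep w).
  have : q * - (q ^ m * B) <= q * re_pair_sum (fun t => ei ((w + v) * t) * h t)%C.
    by apply: Rmult_le_compat_l; [lra|exact: IH].
  by rewrite /=; lra.
move=> w; apply: Rnot_lt_le => hneg; set a := re_pair_sum _ in hneg.
have [m hm] := pow_lt_1_zero q ltac:(rewrite Rabs_pos_eq; lra) (- a / (B + 1)) ltac:(apply: Rdiv_lt_0_compat; lra).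
have := hm m (Nat.le_refl m); have hq0 := pow_le q m ltac:(lra); rewrite Rabs_pos_eq //.
move=> /Rlt_div_r h1; have := h1 ltac:(lra).
have := hpow m w; rewrite -/a; nra.
Qed.

(** The Poisson kernel without its numerator, [1 / |1 - q ei x|^2]. *)
Definition poisson q x := / (1 - 2 * q * cos x + q * q).

Lemma poissonE q x : 0 <= q < 1 ->
  RtoC (poisson q x) = (/ (1 - RtoC q * ei x) * / (1 - RtoC q * ei (- x)))%C.
Proof.
move=> hq; rewrite /poisson RtoC_inv; last first.
  have := COS_bound x; nra.
have <- : ((1 - RtoC q * ei x) * (1 - RtoC q * ei (- x)))%C =
    RtoC (1 - 2 * q * cos x + q * q).
  rewrite /ei cos_neg sin_neg /RtoC /Cmult /Cminus /Cplus /Copp /=; congr pair; last by ring.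
  have := sin2_cos2 x; rewrite /Rsqr => h.
  have -> : 1 - 2 * q * cos x + q * q = 1 - 2 * q * cos x + q * q * (sin x * sin x + cos x * cos x) by rewrite h; ring.
  ring.
field; split; exact: one_minus_ei_neq0.
Qed.

Lemma preserving_poisson q v : 0 <= q < 1 ->
  positivity_preserving (fun t => RtoC (poisson q (v * t))).
Proof.
move=> hq.
have h := preserving_mul _ _ (preserving_geom q v hq) (preserving_geom q (- v) hq).
apply: preserving_ext h => t /=; rewrite poissonE //.
by rewrite Ropp_mult_distr_l.
Qed.

(** Multiplying the Poisson kernel by [ei x - q] cancels one of its two
   geometric factors and leaves [ei x / (1 - q ei x)]. *)
Lemma preserving_shift_poisson q v : 0 <= q < 1 ->
  positivity_preserving (fun t => (ei (v * t) - RtoC q) * RtoC (poisson q (v * t)))%C.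
Proof.
move=> hq.
have h := preserving_mul _ _ (preserving_ei v) (preserving_geom q v hq).
apply: preserving_ext h => t /=; rewrite poissonE //.
have e : (ei (v * t) * ei (- (v * t)) = 1)%C by rewrite -eiD Rplus_opp_r ei0.
have -> : (ei (v * t) - q = ei (v * t) * (1 - q * ei (- (v * t))))%C.
  transitivity (ei (v * t) - q * (ei (v * t) * ei (- (v * t))))%C; first by rewrite e; ring.
  ring.
field; split; exact: one_minus_ei_neq0.
Qed.
End Resonance.

(** * The resonator *)

(** [|R(t)|^2] for the resonator [R(t) = \prod_p 1 / (1 - q_p p^(i t))] with
   [q_p = 1 - p / X]. *)
Definition resonator_sq (X : nat) (ps : seq nat) (t : R) : R :=
  \big[Rmult/1]_(p <- ps) poisson (1 - INR p / INR X) (ln (INR p) * t).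

Definition primes_upto X := [seq p <- index_iota 1 X.+1 | prime p].

Lemma resonator_sq_cons X p ps t : resonator_sq X (p :: ps) t =
  poisson (1 - INR p / INR X) (ln (INR p) * t) * resonator_sq X ps t.
Proof. by rewrite /resonator_sq big_cons. Qed.

Lemma mem_primes_upto X p : (p \in primes_upto X) = prime p && (p <= X)%N.
Proof.
rewrite mem_filter mem_index_iota ltnS; case: (boolP (prime p)) => //= hp.
by rewrite prime_gt0.
Qed.

Lemma ratio_range X p : prime p -> (p <= X)%N -> 0 <= 1 - INR p / INR X < 1.
Proof.
move=> hp hpX; have p0 := INR_gt0 _ (prime_gt0 hp); have h := INR_leq _ _ hpX.
have : 0 < INR p / INR X by apply: Rdiv_lt_0_compat; lra.
have : INR p / INR X <= 1 by apply/Rle_div_l; lra.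
lra.
Qed.

Section Weights.
Variables (K X : nat).

Lemma preserving_resonator_sq ps : {subset ps <= primes_upto X} ->
  positivity_preserving K (fun t => RtoC (resonator_sq X ps t)).
Proof.
elim: ps => [|p ps IH] h.
  apply: preserving_ext (preserving_one K) => t; by rewrite /resonator_sq big_nil.
have := h p (mem_head _ _); rewrite mem_primes_upto => /andP[hp hpX].
have h1 := preserving_poisson K _ (ln (INR p)) (ratio_range X p hp hpX).
have h2 : positivity_preserving K (fun t => RtoC (resonator_sq X ps t)).
  by apply: IH => q hq; apply: h; rewrite in_cons hq orbT.
apply: preserving_ext (preserving_mul _ _ _ h1 h2) => t /=.
by rewrite resonator_sq_cons RtoC_mult.
Qed.

Lemma preserving_shift_prime ps p : {subset ps <= primes_upto X} -> p \in ps ->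
  positivity_preserving K (fun t =>
    (ei (ln (INR p) * t) - RtoC (1 - INR p / INR X)) * RtoC (resonator_sq X ps t))%C.
Proof.
elim: ps => [//|q ps IH] h hp.
have := h q (mem_head _ _); rewrite mem_primes_upto => /andP[hq hqX].
have hps : {subset ps <= primes_upto X} by move=> r hr; apply: h; rewrite in_cons hr orbT.
move: hp; rewrite in_cons; case: eqVneq => [->|_] /= hp.
  have h1 := preserving_shift_poisson K _ (ln (INR q)) (ratio_range X q hq hqX).
  apply: preserving_ext (preserving_mul _ _ _ h1 (preserving_resonator_sq ps hps)) => t /=.
  by rewrite resonator_sq_cons RtoC_mult; ring.
have h1 := preserving_poisson K _ (ln (INR q)) (ratio_range X q hq hqX).
apply: preserving_ext (preserving_mul _ _ _ h1 (IH hps hp)) => t /=.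
by rewrite resonator_sq_cons RtoC_mult; ring.
Qed.

Let W t := resonator_sq X (primes_upto X) t.

(** The factor [ei(t ln n) - q_n], with [q_n] completely multiplicative, would
   do; using the smaller [1 - sopfr(n) / X] directly avoids defining [q_n].
   For [n = p m] and [a = p / X], [b = sopfr(m) / X],
   [e_p e_m - (1 - a - b) = e_m (e_p - (1 - a)) + (1 - a) (e_m - (1 - b)) + a b]. *)
Lemma preserving_shift n : (0 < X)%N -> (0 < n)%N -> smooth X n ->
  positivity_preserving K (fun t =>
    (ei (ln (INR n) * t) - RtoC (1 - sopfr X n / INR X)) * RtoC (W t))%C.
Proof.
move=> X0; move: n; have hX := INR_gt0 _ X0.
have hW : positivity_preserving K (fun t => RtoC (W t)) by exact: preserving_resonator_sq.
have sopfr_ge0 n : 0 <= sopfr X n.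
  by apply: rsum_ge0 => p _; apply: Rmult_le_pos; exact: pos_INR.
apply: smooth_ind.
  apply: preserving_ext (preserving_scal K 0 _ ltac:(lra) hW) => t.
  have -> : sopfr X 1 = 0 by apply: big1 => p _; rewrite logn1 INR0; lra.
  by rewrite INR1 ln_1 Rmult_0_l ei0 /Rdiv Rmult_0_l Rminus_0_r; ring.
move=> p n hp hpX n0 hn IH.
have hpin : p \in primes_upto X by rewrite mem_primes_upto hp.
have h1 := preserving_shift_prime _ _ (fun q hq => hq) hpin.
have h2 := preserving_mul _ _ _ (preserving_ei K (ln (INR n))) h1.
have hr := ratio_range X p hp hpX.
have h3 := preserving_scal _ _ _ (proj1 hr) IH.
have hpos : 0 <= INR p / INR X * (sopfr X n / INR X).
  by apply: Rmult_le_pos; apply: Rdiv_le_0_compat => //; exact: pos_INR.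
have h4 := preserving_scal _ _ _ hpos hW.
apply: preserving_ext (preserving_add _ _ _ (preserving_add _ _ _ h2 h3) h4) => t /=.
rewrite {3}/sopfr (rsum_lognM X p n INR) // -/(sopfr X n) -/(W t).
rewrite INRM ln_mult; try by apply: INR_gt0; rewrite // prime_gt0.
rewrite Rmult_plus_distr_r eiD.
have -> : 1 - (INR p + sopfr X n) / INR X = 1 - INR p / INR X - sopfr X n / INR X by field; lra.
set a := INR p / INR X; set b := sopfr X n / INR X.
rewrite !RtoC_minus RtoC_mult; ring.
Qed.

Definition pair_sum (f : R -> R) := \rsum_(0 <= j < K) \rsum_(0 <= l < K) f (INR j - INR l).

Lemma re_pair_sum_cos v (f : R -> R) :
  re_pair_sum K (fun t => ei (v * t) * RtoC (f t))%C = pair_sum (fun t => cos (v * t) * f t).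
Proof.
by apply: eq_bigr => j _; apply: eq_bigr => l _; rewrite /Re /ei /=; ring.
Qed.

(** The mean of [n^(-i t)] against the resonator; for [n] with a prime factor
   beyond [X] only its nonnegativity is used. *)
Lemma pair_sum_cos_ge n : (0 < X)%N -> (0 < n)%N ->
  (if smooth X n then 1 - sopfr X n / INR X else 0) * pair_sum W <=
  pair_sum (fun t => cos (ln (INR n) * t) * W t).
Proof.
move=> X0 n0; case: ifP => hn; rewrite -re_pair_sum_cos.
  have := preserving_shift n X0 n0 hn _ (positive_definite_one K) 0.
  set c := 1 - _.
  rewrite (re_pair_sum_ext _ _ (fun t => ei (ln (INR n) * t) * RtoC (W t) + RtoC (- c) * (ei (0 * t) * RtoC (W t)))%C); last first.
    by move=> t; rewrite Rmult_0_l ei0 RtoC_opp; ring.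
  rewrite re_pair_sum_add re_pair_sum_scal !re_pair_sum_cos.
  have -> : pair_sum (fun t => cos (0 * t) * W t) = pair_sum W.
    by apply: eq_bigr => j _; apply: eq_bigr => l _; rewrite Rmult_0_l cos_0; lra.
  lra.
rewrite Rmult_0_l.
have := preserving_resonator_sq (primes_upto X) (fun q hq => hq) _ (positive_definite_one K) (ln (INR n)).
rewrite (re_pair_sum_ext _ _ (fun t => ei (ln (INR n) * t) * RtoC (W t))%C) // => t.
by rewrite -/(W t); ring.
Qed.

End Weights.

(** From [(1 - q)^2 <= |1 - q ei x|^2 <= 4]. *)
Lemma poisson_bounds q x : 0 <= q < 1 -> 
  [/\ 0 < poisson q x, poisson q x <= poisson q 0 & poisson q 0 <= 4 / ((1 - q) * (1 - q)) * poisson q x].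
Proof.
move=> hq; have hc := COS_bound x; rewrite /poisson cos_0.
have h0 : 0 < 1 - 2 * q * 1 + q * q by nra.
have h1 : 1 - 2 * q * 1 + q * q <= 1 - 2 * q * cos x + q * q by nra.
have h4 : 1 - 2 * q * cos x + q * q <= 4 by nra.
split.
- by apply: Rinv_0_lt_compat; lra.
- by apply: Rinv_le_contravar.
have -> : (1 - q) * (1 - q) = 1 - 2 * q * 1 + q * q by ring.
rewrite -[X in X <= _]Rmult_1_l /Rdiv.
have : / 4 <= / (1 - 2 * q * cos x + q * q) by apply: Rinv_le_contravar; lra.
have := Rinv_0_lt_compat _ h0; nra.
Qed.

Lemma resonator_sq_bounds X ps t : (0 < X)%N -> {subset ps <= primes_upto X} ->
  [/\ 0 < resonator_sq X ps t, resonator_sq X ps t <= resonator_sq X ps 0 &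
   resonator_sq X ps 0 <= exp (\big[Rplus/0]_(p <- ps) (2 * (ln (INR X) - ln (INR p)) + 2)) * resonator_sq X ps t].
Proof.
move=> X0; elim: ps => [|p ps IH] h.
  by rewrite /resonator_sq !big_nil exp_0; split; lra.
have := h p (mem_head _ _); rewrite mem_primes_upto => /andP[hp hpX].
have [i1 i2 i3] : [/\ 0 < resonator_sq X ps t, resonator_sq X ps t <= resonator_sq X ps 0 &
   resonator_sq X ps 0 <= exp (\big[Rplus/0]_(p <- ps) (2 * (ln (INR X) - ln (INR p)) + 2)) * resonator_sq X ps t].
  by apply: IH => q hq; apply: h; rewrite in_cons hq orbT.
have [j1 j2 j3] := poisson_bounds _ (ln (INR p) * t) (ratio_range X p hp hpX).
rewrite !resonator_sq_cons Rmult_0_r big_cons /= exp_plus.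
set P := poisson _ _ in j1 j2 j3 *; set P0 := poisson _ 0 in j2 j3 *.
set w := resonator_sq _ _ t in i1 i2 i3 *; set w0 := resonator_sq _ _ 0 in i2 i3 *.
split; try nra.
have hk : 4 / ((1 - (1 - INR p / INR X)) * (1 - (1 - INR p / INR X))) <= exp (2 * (ln (INR X) - ln (INR p)) + 2).
  have hX := INR_gt0 _ X0; have hp0 := INR_gt0 _ (prime_gt0 hp).
  have -> : 4 / ((1 - (1 - INR p / INR X)) * (1 - (1 - INR p / INR X))) = 4 * ((INR X / INR p) * (INR X / INR p)) by field; lra.
  have -> : 2 * (ln (INR X) - ln (INR p)) + 2 = (1 + 1) + (ln (INR X / INR p) + ln (INR X / INR p)).
    by rewrite ln_div //; lra.
  rewrite !exp_plus exp_ln; last by apply: Rdiv_lt_0_compat.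
  have : 2 <= exp 1 by have := exp_ineq1_le 1; lra.
  have : 0 < INR X / INR p by apply: Rdiv_lt_0_compat.
  move=> h1 h2; have : 4 <= exp 1 * exp 1 by nra.
  nra.
set e1 := exp (2 * _ + 2) in hk *; set e2 := exp _ in i3 *.
have k1 : P0 <= e1 * P by nra.
have -> : e1 * e2 * (P * w) = (e1 * P) * (e2 * w) by ring.
apply: Rmult_le_compat => //; lra.
Qed.

Definition zeta_re (N : nat) (t : R) := \rsum_(1 <= n < N.+1) (/ INR n * cos (ln (INR n) * t)).

Lemma zeta_re_opp N t : zeta_re N (- t) = zeta_re N t.
Proof. by apply: eq_bigr => n _; rewrite Ropp_mult_distr_r_reverse cos_neg. Qed.

Lemma zeta_re_le N t : zeta_re N t <= harmonic N.
Proof.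
apply: rsum_le => n _ _; have := COS_bound (ln (INR n) * t); have := inv_INR_ge0 n; nra.
Qed.

Lemma count_near K d j :
  (count (fun l => (j < l + d) && (l < j + d)) (index_iota 0 K) <= 2 * d)%N.
Proof.
rewrite -size_filter.
apply: leq_trans (_ : size (index_iota (j - d) (j + d)) <= _)%N; last by rewrite size_iota; lia.
apply: uniq_leq_size; first by rewrite filter_uniq // iota_uniq.
move=> l; rewrite mem_filter !mem_index_iota; lia.
Qed.

(** Each prime contributes [ln (4 (X/p)^2)], with [ln 4] rounded up to [2]. *)
Definition resonator_exponent X := \rsum_(1 <= p < X.+1 | prime p) (2 * (ln (INR X) - ln (INR p)) + 2).

(** Compare the two bounds for the mean of [Re zeta_N(1 + i(j - l))] against the
   resonator. Below it is the resonated sum. Above, pairs at distance at least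
   [d] contribute at most [M], and the at most [2 d K] close pairs contribute at
   most [harmonic N] times the value of the resonator at [0], which exceeds its
   other values by a factor at most [exp (resonator_exponent X)]. *)
Lemma resonance (X K N d : nat) (M : R) : (0 < X)%N -> (0 < K)%N -> 0 <= M ->
  (forall k, (d <= k < K)%N -> zeta_re N (INR k) <= M) ->
  \rsum_(1 <= n < N.+1 | smooth X n) ((1 - sopfr X n / INR X) * / INR n) <=
  M + 2 * INR d * harmonic N * exp (resonator_exponent X) / INR K.
Proof.
move=> X0 K0 M0 hM.
set Sig := \big[_/_]_(_ <= _ < _ | _) _.
pose W t := resonator_sq X (primes_upto X) t.
pose E := resonator_exponent X.
have hWb t : [/\ 0 < W t, W t <= W 0 & W 0 <= exp E * W t].
  have := resonator_sq_bounds X (primes_upto X) t X0 (fun q hq => hq).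
  by rewrite /E /resonator_exponent -[\rsum_(1 <= p < X.+1 | prime p) _]big_filter.
have w0 : 0 < W 0 by case: (hWb 0).
have hE := exp_pos E.
have hK := INR_gt0 _ K0.
pose P := pair_sum K W.
have HN : 0 <= harmonic N by apply: rsum_ge0 => n _; exact: inv_INR_ge0.
have lower : Sig * P <= pair_sum K (fun t => zeta_re N t * W t).
  apply: Rle_trans (_ : \rsum_(1 <= n < N.+1) (/ INR n * pair_sum K (fun t => cos (ln (INR n) * t) * W t)) <= _).
    rewrite /Sig big_mkcond big_distrl /= big_nat [X in _ <= X]big_nat.
    apply: rsum_le => n _ /andP[n0 _].
    have hn : (if smooth X n then 1 - sopfr X n / INR X else 0) * P <=
        pair_sum K (fun t => cos (ln (INR n) * t) * W t).
      exact: pair_sum_cos_ge.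
    have := Rmult_le_compat_l _ _ _ (inv_INR_ge0 n) hn.
    case: ifP => _; lra.
  right; rewrite /pair_sum.
  under eq_bigr => n _.
    rewrite big_distrr /=.
    under eq_bigr => j _ do rewrite big_distrr /=.
    over.
  rewrite exchange_big /=; apply: eq_bigr => j _.
  rewrite exchange_big /=; apply: eq_bigr => l _.
  rewrite /zeta_re big_distrl /=; apply: eq_bigr => n _; lra.
have upper : pair_sum K (fun t => zeta_re N t * W t) <=
    M * P + INR K * (2 * INR d) * (harmonic N * W 0).
  pose near j l := ((j < l + d) && (l < j + d))%N.
  apply: Rle_trans (_ : \rsum_(0 <= j < K) \rsum_(0 <= l < K) 
     (M * W (INR j - INR l) + if near j l then harmonic N * W 0 else 0) <= _).
    rewrite /pair_sum big_nat [X in _ <= X]big_nat; apply: rsum_le => j _ /andP[_ hj].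
    rewrite big_nat [X in _ <= X]big_nat; apply: rsum_le => l _ /andP[_ hl].
    have [h1 h2 _] := hWb (INR j - INR l).
    have hz := zeta_re_le N (INR j - INR l).
    case: ifP => hn.
      have : zeta_re N (INR j - INR l) * W (INR j - INR l) <= harmonic N * W (INR j - INR l).
        by apply: Rmult_le_compat_r; lra.
      have : harmonic N * W (INR j - INR l) <= harmonic N * W 0.
        by apply: Rmult_le_compat_l.
      have : 0 <= M * W (INR j - INR l) by apply: Rmult_le_pos; lra.
      lra.
    rewrite Rplus_0_r; apply: Rmult_le_compat_r; first lra.
    case: (leqP l j) => hlj.
      rewrite -minus_INR; last by apply/leP.
      apply: hM; move: hn; rewrite /near; lia.
    rewrite -zeta_re_opp Ropp_minus_distr -minus_INR; last by apply/leP; exact: ltnW.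
    apply: hM; move: hn; rewrite /near; lia.
  under eq_bigr => j _ do rewrite big_split /= -big_distrr /= -big_mkcond /= rsum_const.
  rewrite big_split /= -big_distrr /= -/(pair_sum K W) -/P; apply: Rplus_le_compat_l.
  rewrite -big_distrl /=.
  have h0 : 0 <= harmonic N * W 0 by apply: Rmult_le_pos; lra.
  apply: Rmult_le_compat_r => //.
  apply: Rle_trans (_ : \rsum_(0 <= j < K) (2 * INR d) <= _).
    apply: rsum_le => j _ _; have := INR_leq _ _ (count_near K d j); rewrite INRM.
    by have -> : INR 2 = 2 by rewrite /INR; ring.
  by rewrite rsum_const count_predT size_iota subn0; lra.
have hP : INR K * (INR K * W 0) <= exp E * P.
  rewrite /P /pair_sum big_distrr /=.
  apply: Rle_trans (_ : \rsum_(0 <= j < K) (INR K * W 0) <= _).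
    by rewrite rsum_const count_predT size_iota subn0; lra.
  apply: rsum_le => j _ _; rewrite big_distrr /=.
  apply: Rle_trans (_ : \rsum_(0 <= l < K) W 0 <= _).
    by rewrite rsum_const count_predT size_iota subn0; lra.
  by apply: rsum_le => l _ _; case: (hWb (INR j - INR l)).
suff : Sig - M <= 2 * INR d * harmonic N * exp E / INR K by rewrite /E; lra.
have hd := pos_INR d.
case: (Rle_dec (Sig - M) 0) => hs.
  apply: Rle_trans hs _; apply: Rdiv_le_0_compat => //.
  by repeat apply: Rmult_le_pos => //; lra.
apply/Rle_div_r => //.
apply: (Rmult_le_reg_r (INR K * W 0)); first exact: Rmult_lt_0_compat.
have h1 : (Sig - M) * (INR K * (INR K * W 0)) <= (Sig - M) * (exp E * P).
  by apply: Rmult_le_compat_l; lra.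
have h2 : exp E * ((Sig - M) * P) <= exp E * (INR K * (2 * INR d) * (harmonic N * W 0)).
  by apply: Rmult_le_compat_l; lra.
lra.
Qed.

(** * The partial sums of zeta on the line of real part one *)

Lemma npow_opp_line n t :
  npow_opp n (1, t) = (exp (- ln (INR n)) * cos (ln (INR n) * t), - (exp (- ln (INR n)) * sin (ln (INR n) * t))).
Proof.
rewrite /npow_opp /Cexp /Cmult /Copp /RtoC /Re /Im /=.
have -> : -1 * ln (INR n) - - t * 0 = - ln (INR n) by ring.
have -> : -1 * 0 + - t * ln (INR n) = - (ln (INR n) * t) by ring.
by rewrite cos_neg sin_neg; congr pair; ring.
Qed.

Lemma zeta_partial_line N t :
  zeta_partial N (1, t) =
  (zeta_re (Z.to_nat (Zfloor N)) t,
   \rsum_(1 <= n < (Z.to_nat (Zfloor N)).+1) (- (/ INR n * sin (ln (INR n) * t)))).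
Proof.
rewrite /zeta_partial /zeta_re; elim: (Z.to_nat _) => [|k IH].
  by rewrite sum_n_m_zero ?big_geq //; apply/ltP.
rewrite sum_n_Sm; last by apply/leP.
rewrite IH (big_nat_recr k.+1) // (big_nat_recr k.+1) //= npow_opp_line exp_Ropp exp_ln //.
by apply: INR_gt0.
Qed.

Lemma continuity_rsum (I : Type) (s : seq I) (P : pred I) (f : I -> R -> R) x :
  (forall i, continuity_pt (f i) x) ->
  continuity_pt (fun t => \big[Rplus/0]_(i <- s | P i) f i t) x.
Proof.
move=> h; elim: s => [|i s IH].
  apply: (continuity_pt_ext (fun=> 0)) => [t|]; first by rewrite big_nil.
  exact: continuity_pt_const.
case hP : (P i).
  apply: (continuity_pt_ext (fun t => f i t + \big[Rplus/0]_(i <- s | P i) f i t)) => [t|].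
    by rewrite big_cons hP.
  by apply: continuity_pt_plus.
apply: continuity_pt_ext IH => t; by rewrite big_cons hP.
Qed.

Lemma continuity_zeta_partial N x :
  continuity_pt (fun t => Cmod (zeta_partial N (1, t))) x.
Proof.
set k := Z.to_nat (Zfloor N).
apply: (continuity_pt_ext (fun t => sqrt (zeta_re k t ^ 2 +
   (\rsum_(1 <= n < k.+1) (- (/ INR n * sin (ln (INR n) * t)))) ^ 2))) => [t|].
  by rewrite zeta_partial_line.
apply: (continuity_pt_comp (fun t => zeta_re k t ^ 2 +
   (\rsum_(1 <= n < k.+1) (- (/ INR n * sin (ln (INR n) * t)))) ^ 2) sqrt); last first.
  by apply: continuity_pt_sqrt; nra.
have sq (f : R -> R) : continuity_pt f x -> continuity_pt (fun t => f t ^ 2) x.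
  move=> hf; apply: (continuity_pt_ext (fun t => f t * f t)) => [t|]; first by rewrite /=; ring.
  exact: continuity_pt_mult.
have lin c : continuity_pt (fun t => c * t) x by reg.
apply: continuity_pt_plus; apply: sq; apply: continuity_rsum => n; reg.
Qed.

Lemma zeta_partial_max_exists N a b : a <= b ->
  exists2 M, is_max_on (fun t => Cmod (zeta_partial N (1, t))) a b M & 0 <= M.
Proof.
move=> hab.
have [t [h1 h2]] := continuity_ab_maj _ a b hab (fun c _ => continuity_zeta_partial N c).
by exists (Cmod (zeta_partial N (1, t))); [split; [exists t|]|exact: Cmod_ge_0].
Qed.

(** * Choice of the parameters *)

Lemma resonator_exponent_le X : (1 < X)%N ->
  resonator_exponent X * ln (INR X) <= 88 * INR X.
Proof.
move=> X1; rewrite /resonator_exponent.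
rewrite (eq_bigr (fun p => 2 * (ln (INR X) - ln (INR p)) + 2 * 1)); last by move=> p _; lra.
rewrite big_split /= -!big_distrr /= -/(primepi X).
have := sum_ln_ratio_primes X X1; have := primepi_le X (ltnW X1); lra.
Qed.

(** The coefficients [1 - sopfr(n) / X] cost [2 pi(X) / X] times the smooth sum,
   and [pi(X) / X = O(1 / ln X)]. *)
Lemma resonated_sum_ge X N : (1 < X)%N -> (0 < N)%N ->
  smooth_sum X N - 28 * (1 + ln (INR N)) / ln (INR X) <=
  \rsum_(1 <= n < N.+1 | smooth X n) ((1 - sopfr X n / INR X) * / INR n).
Proof.
move=> X1 N0; have X0 := ltnW X1; have hX := INR_gt0 _ X0.
have hY := lnX_ge X X1.
rewrite (eq_bigr (fun n => / INR n - / INR X * (sopfr X n * / INR n))); last by move=> n _; rewrite /Rdiv; ring.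
rewrite rsum_minus -big_distrr /= -/(smooth_sum X N).
have h1 := smooth_sum_sopfr_le X N.
have h2 : smooth_sum X N <= 1 + ln (INR N).
  exact: Rle_trans (smooth_sum_le X N) (harmonic_le N N0).
have h3 := primepi_le X X0; have p0 := primepi_ge0 X; have S0 := smooth_sum_ge0 X N.
have h4 : primepi X / INR X <= 14 / ln (INR X).
  apply/Rle_div_l => //; rewrite /Rdiv Rmult_assoc (Rmult_comm (/ _)) -Rmult_assoc.
  by apply/Rle_div_r; lra.
have h5 : 0 <= primepi X / INR X by apply: Rdiv_le_0_compat.
have : / INR X * \rsum_(1 <= n < N.+1 | smooth X n) (sopfr X n * / INR n) <=
   2 * (primepi X / INR X) * smooth_sum X N.
  have -> : 2 * (primepi X / INR X) * smooth_sum X N = / INR X * (2 * primepi X * smooth_sum X N) by rewrite /Rdiv; ring.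
  by apply: Rmult_le_compat_l => //; exact: inv_INR_ge0.
have : 2 * (primepi X / INR X) * smooth_sum X N <= 2 * (14 / ln (INR X)) * (1 + ln (INR N)).
  apply: Rmult_le_compat => //; lra.
have -> : 28 * (1 + ln (INR N)) / ln (INR X) = 2 * (14 / ln (INR X)) * (1 + ln (INR N)).
  by field; lra.
lra.
Qed.

Section Scale.
Variable rho : R -> R.
Hypothesis hrho : is_dickman rho.
Let F := dickman_int rho.

(** [F] is nondecreasing and [1]-Lipschitz: raising the argument from [l / Z] to
   [l / Y] only helps, and the change of the prefactor costs [(Z - Y) F(l / Z)].
   The last [1] absorbs the passage from a real [l'] to the logarithm [l] of an
   integer. *)
Lemma dickman_rescale Y Z l l' : 0 < Y -> Y <= Z -> 0 <= l -> l <= l' -> l' <= l + 1 ->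
  Z * F (l' / Z) <= Y * F (l / Y) + (Z - Y) * (l / Z) + 1.
Proof.
move=> hY hYZ hl hll hl1.
have h1 : F (l' / Z) - F (l / Z) <= l' / Z - l / Z.
  apply: dickman_int_lip => //; apply: Rmult_le_compat_r => //.
  by apply: Rlt_le; apply: Rinv_0_lt_compat; lra.
have h2 : Z * (l' / Z - l / Z) = l' - l by field; lra.
have h3 : F (l / Z) <= F (l / Y).
  apply: dickman_int_mono => //; apply: Rmult_le_compat_l => //.
  by apply: Rinv_le_contravar.
have h4 : F (l / Z) <= l / Z.
  by apply: dickman_int_le => //; apply: Rdiv_le_0_compat; lra.
nra.
Qed.
End Scale.

Theorem theorem1p1 :
  forall theta B : R, 0 < theta < 1 -> 1 <= B ->
  exists K T0 : R, 0 < K /\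
  forall rho : R -> R, is_dickman rho ->
  forall T N : R, T0 <= T ->
    2 <= N <= Rpower (ln T * iter_log 2 T) B ->
    exists M : R,
      is_max_on (fun t => Cmod (zeta_partial N (1, t))) (Rpower T theta) T M /\
      M >= (iter_log 2 T + iter_log 3 T)
           * RInt rho 0 (ln N / (iter_log 2 T + iter_log 3 T)) - K.
Proof.
move=> theta B htheta hB.
pose del := (1 - theta) / 4.
have hdel : 0 < del by rewrite /del; lra.
pose c := del / 176.
have hc : 0 < c < 1 by rewrite /c /del; lra.
pose kc := ln (2 / c).
have hkc : 0 <= kc.
  rewrite -ln_1; apply: ln_le; first lra.
  by apply/Rle_div_r; lra.
pose V := 3 + 24 * B / (del * del) + 3 / c + exp (2 * kc).
pose Cst := 45 * exp (6 * B) + 56 * (B + 1) + kc * B + 2.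
exists Cst, (exp V); split.
  by have := exp_pos (6 * B); rewrite /Cst; nra.
move=> rho hrho T N hT [hN2 hN]; rewrite /iter_log /= in hN *.
set v := ln T in hN *; set L2 := ln v in hN *; set L3 := ln L2.
have hT0 : 0 < T by apply: Rlt_le_trans hT; exact: exp_pos.
have hv : V <= v by rewrite -(ln_exp V); apply: ln_le => //; exact: exp_pos.
have hTv : T = exp v by rewrite exp_ln.
have p1 : 0 < 24 * B / (del * del) by apply: Rdiv_lt_0_compat; nra.
have p2 : 0 < 3 / c by apply: Rdiv_lt_0_compat; lra.
have p3 := exp_pos (2 * kc).
have v3 : 3 <= v by rewrite /V in hv; lra.
have vc : 3 <= c * v.
  have : c * (3 / c) <= c * v by apply: Rmult_le_compat_l; rewrite /V in hv; lra.
  have -> : c * (3 / c) = 3 by field; lra.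
  lra.
have vB : 24 * B <= del * del * v.
  have : (del * del) * (24 * B / (del * del)) <= (del * del) * v.
    by apply: Rmult_le_compat_l; [nra|rewrite /V in hv; lra].
  have -> : (del * del) * (24 * B / (del * del)) = 24 * B by field; lra.
  lra.
have L2k : 2 * kc <= L2.
  by rewrite -(ln_exp (2 * kc)); apply: ln_le => //; rewrite /V in hv; lra.
have L21 : 1 <= L2.
  rewrite -(ln_exp 1); apply: ln_le; first exact: exp_pos.
  by have := exp_le_3; lra.
have L30 : 0 <= L3 by rewrite -ln_1; apply: ln_le; lra.
have L3L2 : L3 <= L2 by have := ln_le_sub1 L2; rewrite -/L3; lra.
have L2v : L2 <= v by have := ln_le_sub1 v; rewrite -/L2; lra.
pose y := v * L2; pose Z := L2 + L3.
have hyZ : ln y = Z by rewrite /y ln_mult //; lra.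
have hyv : v <= y by rewrite /y; nra.
(* The resonator uses primes up to [c ln T ln ln T]; with [c] proportional to
   [1 - theta], its values range over a factor at most [T^del]. *)
have [X [hX1 hX2]] := floor_nat (c * y) ltac:(nra).
have cy : 3 <= c * y by nra.
have X1 : (1 < X)%N.
  rewrite ltnNge; apply/negP => /INR_leq; rewrite INR1; rewrite S_INR in hX2; lra.
have hX := INR_gt0 _ (ltnW X1).
pose Y := ln (INR X).
have YZ : Y <= Z by rewrite -hyZ; apply: ln_le => //; nra.
have ZY : Z - kc <= Y.
  have : ln (y / (2 / c)) <= Y.
    apply: ln_le.
      by apply: Rdiv_lt_0_compat; [lra|apply: Rdiv_lt_0_compat; lra].
    have -> : y / (2 / c) = c * y / 2 by field; lra.
    by rewrite S_INR in hX2; lra.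
  by rewrite ln_div ?hyZ -/kc //; [lra|apply: Rdiv_lt_0_compat; lra].
have L2Z : L2 <= Z by rewrite /Z; lra.
have Yhalf : Z / 2 <= Y by lra.
have hE : resonator_exponent X <= del * v.
  have h := resonator_exponent_le X X1; rewrite -/Y in h.
  apply: (Rmult_le_reg_r Y); first by rewrite /Z in Yhalf; lra.
  apply: Rle_trans h _.
  have : 88 * INR X <= 88 * (c * y) by lra.
  have -> : 88 * (c * y) = del * v * (L2 / 2) by rewrite /c /y; field.
  have : del * v * (L2 / 2) <= del * v * Y.
    by apply: Rmult_le_compat_l; [nra|rewrite /Z in Yhalf; lra].
  lra.
pose n := Z.to_nat (Zfloor N).
have [hn1 hn2] : INR n <= N < INR n + 1.
  have hz := Zfloor_bound N; rewrite INR_IZR_INZ.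
  have h0 : (0 < Zfloor N + 1)%Z by apply: lt_IZR; rewrite plus_IZR; lra.
  have -> : Z.of_nat n = Zfloor N by rewrite /n; lia.
  lra.
have n0 : (0 < n)%N by case: posnP hn2 => // ->; rewrite INR0; lra.
have hn := INR_gt0 _ n0; have hn1' := INR_ge1 _ n0.
have lnN : ln N <= B * Z.
  have -> : B * Z = ln (Rpower y B) by rewrite /Rpower ln_exp hyZ.
  by apply: ln_le; [lra|exact: hN].
have lnn : ln (INR n) <= ln N by apply: ln_le.
have lnn2 : ln N <= ln (INR n) + 1.
  apply: Rle_trans (_ : ln (INR n * 2) <= _); first by apply: ln_le; lra.
  by rewrite ln_mult //; [have := ln_le_sub1 2; lra|lra].
have lnn0 := ln_INR_ge0 n.
(* Differences of integers below [k] stay in [[-T, T]], and those of absolute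
   value at least [d] are beyond [T^theta]. *)
have [k [hk1 hk2]] := floor_nat T (Rlt_le _ _ hT0).
have hTth : 1 <= Rpower T theta.
  by rewrite -(Rpower_O T) //; apply: Rle_Rpower; [rewrite hTv; have := exp_ineq1_le v|]; lra.
have hTle : Rpower T theta <= T.
  by rewrite -{2}(Rpower_1 T) //; apply: Rle_Rpower; [rewrite hTv; have := exp_ineq1_le v|]; lra.
have [d' [hd1 hd2]] := floor_nat (Rpower T theta) ltac:(lra).
pose d := d'.+1.
have [M hM M0] := zeta_partial_max_exists N _ _ hTle.
exists M; split; first exact: hM.
have T4 : 4 <= T by rewrite hTv; have := exp_ineq1_le v; lra.
have k0 : (0 < k)%N by case: posnP hk2 => // ->; rewrite INR1; lra.
have hres : forall j, (d <= j < k)%N -> zeta_re n (INR j) <= M.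
  move=> j /andP[h1 h2]; case: hM => _ hM.
  apply: Rle_trans (hM (INR j) _); last first.
    split; first by have := INR_leq _ _ h1; rewrite /d; lra.
    by apply: Rle_trans hk1; apply: INR_leq; exact: ltnW.
  rewrite zeta_partial_line; apply: Rle_trans (Rmax_Cmod _).
  by apply: Rle_trans (Rmax_l _ _); exact: Rle_abs.
have := resonance X k n d M (ltnW X1) k0 M0 hres.
have := resonated_sum_ge X n X1 n0; rewrite -/Y.
have := smooth_sum_lower rho hrho X n X1 n0; rewrite -/Y.
have := dickman_rescale rho hrho Y Z (ln (INR n)) (ln N) ltac:(rewrite /Z in Yhalf; lra) YZ lnn0 lnn lnn2.
rewrite -(dickman_int_RInt rho (ln N / Z)); last first.
  by apply: Rdiv_le_0_compat; rewrite /Z; lra.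
set I := RInt _ _ _; set FY := dickman_int _ _; set S := smooth_sum _ _.
have Z1 : 1 <= Z by rewrite /Z; lra.
have b1 : (Z - Y) * (ln (INR n) / Z) <= kc * B.
  apply: Rmult_le_compat; try lra; first by apply: Rdiv_le_0_compat; lra.
  by apply/Rle_div_l; lra.
have b2 : 28 * (1 + ln (INR n)) / Y <= 56 * (B + 1).
  apply/Rle_div_l; first lra.
  nra.
have b3 : 45 * exp (3 * (ln (INR n) / Y)) <= 45 * exp (6 * B).
  apply: Rmult_le_compat_l; first lra.
  apply: exp_le; suff : ln (INR n) / Y <= 2 * B by lra.
  apply/Rle_div_l; first lra.
  nra.
(* The excluded range: it has density [O(T^(theta - 1))], which beats the
   factor [T^del] of the resonator and the factor [O(ln T)] of [harmonic n]. *)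
have b4 : 2 * INR d * harmonic n * exp (resonator_exponent X) / INR k <= 1.
  apply/Rle_div_l; first exact: INR_gt0.
  have hd : INR d <= 2 * exp (theta * v).
    have -> : exp (theta * v) = Rpower T theta by [].
    by rewrite /d S_INR; lra.
  have hh : harmonic n <= 1 + 2 * B * v.
    by apply: Rle_trans (harmonic_le n n0) _; rewrite /Z in lnN; nra.
  have he : exp (resonator_exponent X) <= exp (del * v) by exact: exp_le.
  have hkT : exp v / 2 <= INR k by rewrite -hTv; rewrite S_INR in hk2; lra.
  have hpoly : 8 * (1 + 2 * B * v) <= exp (2 * del * v).
    have h1 := exp_ineq1_le (del * v).
    have -> : 2 * del * v = del * v + del * v by ring.
    rewrite exp_plus.
    have : 8 * (1 + 2 * B * v) <= (del * v) * (del * v) by nra.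
    have : 0 <= del * v by nra.
    nra.
  have H0 : 0 <= harmonic n by apply: rsum_ge0 => m _; exact: inv_INR_ge0.
  rewrite Rmult_1_l; apply: Rle_trans hkT.
  apply: Rle_trans (_ : 2 * (2 * exp (theta * v)) * (1 + 2 * B * v) * exp (del * v) <= _).
    apply: Rmult_le_compat => //; last apply: Rmult_le_compat => //; last lra.
    - by apply: Rmult_le_pos => //; have := pos_INR d; lra.
    - exact: Rlt_le (exp_pos _).
    - by have := pos_INR d; lra.
  have -> : exp v = exp (theta * v) * exp (2 * del * v) * exp (del * v) * exp (del * v).
    by rewrite -!exp_plus; congr exp; rewrite /del; field.
  have e1 := exp_pos (theta * v); have e2 := exp_pos (del * v).
  have e3 : 1 <= exp (del * v) by have := exp_ineq1_le (del * v); nra.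
  have q1 : 0 < exp (theta * v) * exp (del * v) by nra.
  have q2 : exp (theta * v) * exp (del * v) * (8 * (1 + 2 * B * v)) <=
     exp (theta * v) * exp (del * v) * exp (2 * del * v) by apply: Rmult_le_compat_l; lra.
  have q3 : exp (theta * v) * exp (del * v) * exp (2 * del * v) * 1 <=
     exp (theta * v) * exp (del * v) * exp (2 * del * v) * exp (del * v).
    by apply: Rmult_le_compat_l => //; apply: Rmult_le_pos; [lra|exact: Rlt_le (exp_pos _)].
  lra.
move=> r1 r2 r3 r4; rewrite -/Z /Cst; lra.
Qed.
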